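(* Let $Q\in\mathbb{R}^{d\times d}$, $R\in\mathbb{R}^{p\times p}$, $W\in\mathbb{R}^{d\times d}$ be symmetric positive definite, let $H\ge1$ be an integer, $\alpha\in[0,1)$, and let $(A_t,B_t)_{t\ge1}$ be a sequence with $A_t\in\mathbb{R}^{d\times d}$, $B_t\in\mathbb{R}^{d\times p}$. Suppose that for each $t$ the matrix $$\tilde B_t=[B_{t+H-1},\,A_{t+H-1}B_{t+H-2},\,\dots,\,A_{t+H-1}\cdots A_{t+1}B_t]$$ satisfies $\tilde B_t\tilde B_t^\top\succeq\sigma I$ for some $\sigma>0$ (independent of $t$), and $\|A_t\|\le a$, $\|B_t\|\le b$ for some $a,b>0$. Then the semidefinite program solved in the COCO-LQ-Prediction algorithm is always feasible. Further, when $\alpha<1/2$, the closed-loop system under COCO-LQ-Prediction is input-to-state stable: for any $t$, $$\|x_t\|\le\kappa_A'\,\rho^{\frac tH-1}\|x_1\|+\kappa_A'\,\kappa_A\,\kappa\,\max\Big(1,\frac{\rho}{1-\rho}\Big)\sup_{1\le s<t}\|w_s\|,$$ where $\rho=\sqrt{\frac{\alpha}{1-\alpha}}\in[0,1)$, $\kappa=\frac{\kappa_W}{\sqrt{1-\alpha}}$ with $\kappa_W=\|W\|\,\|W^{-1}\|$ the condition number of $W$, $\kappa_A=1+a+\dots+a^{H-1}$, and $\kappa_A'=a^{H-1}+b^2(1+a+\dots+a^{H-1})^2\,\kappa_R\,\frac{\kappa+a^H}{\sigma}$ with $\kappa_R=\|R\|\,\|R^{-1}\|$ the condition number of $R$.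
   Context: Norms are the Euclidean norm for vectors and the spectral norm for matrices; $X\preceq Y$ means $Y-X$ is positive semidefinite; $X\bullet Y=\mathrm{Tr}(X^\top Y)$. A supremum over an empty index set is $0$. System: $x_{t+1}=A_tx_t+B_tu_t+w_t$, $t\ge1$, with state $x_t\in\mathbb{R}^d$, input $u_t\in\mathbb{R}^p$ and arbitrary disturbances $w_t\in\mathbb{R}^d$; $x_1$ is the initial state. COCO-LQ-Prediction with parameter $\alpha$ and horizon $H$: at each time $t\equiv1\pmod H$, set $\tilde A_t=A_{t+H-1}\cdots A_t$, $\tilde B_t=[B_{t+H-1},A_{t+H-1}B_{t+H-2},\dots,A_{t+H-1}\cdots A_{t+1}B_t]\in\mathbb{R}^{d\times Hp}$, and $\tilde R=\mathrm{diag}(R,\dots,R)\in\mathbb{R}^{Hp\times Hp}$ ($H$ diagonal blocks). Solve the program over symmetric $\Sigma=\begin{bmatrix}\Sigma_{xx}&\Sigma_{xu}\\ \Sigma_{xu}^\top&\Sigma_{uu}\end{bmatrix}\in\mathbb{R}^{(d+Hp)\times(d+Hp)}$, with $\Sigma_{xx}\in\mathbb{R}^{d\times d}$: minimize $\begin{bmatrix}Q&0\\0&\tilde R\end{bmatrix}\bullet\Sigma$ subject to (i) $\Sigma_{xx}=[\tilde A_t\ \ \tilde B_t]\,\Sigma\,[\tilde A_t\ \ \tilde B_t]^\top+W$; (ii) $\Sigma\succeq0$; (iii) $[\tilde A_t\ \ \tilde B_t]\,\Sigma\,[\tilde A_t\ \ \tilde B_t]^\top\preceq\alpha\,\Sigma_{xx}$.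 With an optimal solution $\Sigma$, set $K_t=\Sigma_{xu}^\top\Sigma_{xx}^{-1}\in\mathbb{R}^{Hp\times d}$ and plan the next $H$ inputs by $[u_{t+H-1}^\top,\dots,u_t^\top]^\top=K_tx_t$; these planned inputs are then applied at times $t,\dots,t+H-1$. *)

(* Defs.v *)
From HB Require Import structures.
From mathcomp Require Import all_boot all_order all_algebra.
From mathcomp Require Import all_classical all_reals all_analysis.
Set Implicit Arguments.
Unset Strict Implicit.
Unset Printing Implicit Defensive.
Import Order.TTheory GRing.Theory Num.Theory.
Local Open Scope classical_set_scope.
Local Open Scope ring_scope.

(* [`|v|] on matrices is the max norm in MathComp-Analysis, hence the two norms
   below. *)
Definition enorm (R : realType) (n : nat) (v : 'cV[R]_n) : R :=
  Num.sqrt (\sum_(i < n) v i 0 ^+ 2).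

Definition spnorm (R : realType) (m n : nat) (M : 'M[R]_(m, n)) : R :=
  sup [set enorm (M *m v) | v in [set v : 'cV[R]_n | enorm v <= 1]].

Definition cond_number (R : realType) (n : nat) (M : 'M[R]_n) : R :=
  spnorm M * spnorm (invmx M).

Definition psd (R : realType) (n : nat) (M : 'M[R]_n) : Prop :=
  M^T = M /\ forall v : 'cV[R]_n, 0 <= (v^T *m M *m v) 0 0.

Definition posdef (R : realType) (n : nat) (M : 'M[R]_n) : Prop :=
  M^T = M /\ forall v : 'cV[R]_n, v != 0 -> 0 < (v^T *m M *m v) 0 0.

Definition loewner_le (R : realType) (n : nat) (X Y : 'M[R]_n) : Prop :=
  psd (Y - X).

Definition mxinner (R : realType) (m n : nat) (X Y : 'M[R]_(m, n)) : R :=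
  \tr (X^T *m Y).

(* [r] to the real power [e] for [0 <= r], with [0 `^ e = +oo] for [e < 0]
   (where [powR] returns 0) and [0 `^ 0 = 1]. *)
Definition epow (R : realType) (r e : R) : \bar R :=
  if (r == 0) && (e < 0) then +oo%E else (r `^ e)%:E.

(* [transition A t n = A_(t+n-1) ... A_(t+1) A_t]. *)
Fixpoint transition (R : realType) (d : nat) (A : nat -> 'M[R]_d) (t n : nat)
    : 'M[R]_d :=
  if n is k.+1 then A (t + k)%N *m transition A t k else 1%:M.

(* The dimension H * p of H stacked inputs, in the form used by the library's
   block matrices. *)
Notation stack H p := (\sum_(j < H) p)%N.

Definition lifted_A (R : realType) (d H : nat) (A : nat -> 'M[R]_d) (t : nat)
    : 'M[R]_d :=
  transition A t H.

(* Block j (0 <= j < H) is A_(t+H-1) ... A_(t+H-j) B_(t+H-1-j). *)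
Definition lifted_B (R : realType) (d p H : nat) (A : nat -> 'M[R]_d)
    (B : nat -> 'M[R]_(d, p)) (t : nat) : 'M[R]_(d, stack H p) :=
  \mxrow_(j < H) (transition A (t + H - j)%N j *m B (t + H - j.+1)%N).

Definition lifted_R (R : realType) (p H : nat) (Rc : 'M[R]_p)
    : 'M[R]_(stack H p) :=
  \mxdiag_(j < H) Rc.

(* [A_t B_t] Sigma [A_t B_t]^T for the lifted matrices. *)
Definition propagated (R : realType) (d p H : nat) (A : nat -> 'M[R]_d)
    (B : nat -> 'M[R]_(d, p)) (t : nat) (Sigma : 'M[R]_(d + stack H p))
    : 'M[R]_d :=
  let AB := row_mx (lifted_A H A t) (lifted_B H A B t) in
  AB *m Sigma *m AB^T.

(* Symmetry of Sigma is part of [psd]. *)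
Definition sdp_feasible (R : realType) (d p H : nat) (alpha : R)
    (W : 'M[R]_d) (A : nat -> 'M[R]_d) (B : nat -> 'M[R]_(d, p)) (t : nat)
    (Sigma : 'M[R]_(d + stack H p)) : Prop :=
  [/\ ulsubmx Sigma = propagated A B t Sigma + W,
      psd Sigma
    & loewner_le (propagated A B t Sigma) (alpha *: ulsubmx Sigma)].

Definition sdp_cost (R : realType) (d p H : nat) (Q : 'M[R]_d) (Rc : 'M[R]_p)
    (Sigma : 'M[R]_(d + stack H p)) : R :=
  mxinner (block_mx Q 0 0 (lifted_R H Rc)) Sigma.

Definition sdp_optimal (R : realType) (d p H : nat) (alpha : R)
    (Q : 'M[R]_d) (Rc : 'M[R]_p) (W : 'M[R]_d) (A : nat -> 'M[R]_d)
    (B : nat -> 'M[R]_(d, p)) (t : nat) (Sigma : 'M[R]_(d + stack H p))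
    : Prop :=
  sdp_feasible alpha W A B t Sigma /\
  forall Sigma' : 'M[R]_(d + stack H p),
    sdp_feasible alpha W A B t Sigma' -> sdp_cost Q Rc Sigma <= sdp_cost Q Rc Sigma'.

Definition sdp_gain (R : realType) (d p H : nat)
    (Sigma : 'M[R]_(d + stack H p)) : 'M[R]_(stack H p, d) :=
  (ursubmx Sigma)^T *m invmx (ulsubmx Sigma).

Definition planned_inputs (R : realType) (p H : nat) (u : nat -> 'cV[R]_p)
    (t : nat) : 'cV[R]_(stack H p) :=
  \mxcol_(j < H) u (t + H - j.+1)%N.

(* Time starts at 1; index 0 of every sequence is unused. *)
Definition closed_loop (R : realType) (d p H : nat) (alpha : R)
    (Q : 'M[R]_d) (Rc : 'M[R]_p) (W : 'M[R]_d) (A : nat -> 'M[R]_d)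
    (B : nat -> 'M[R]_(d, p)) (x : nat -> 'cV[R]_d) (u : nat -> 'cV[R]_p)
    (w : nat -> 'cV[R]_d) : Prop :=
  (forall t : nat, (1 <= t)%N -> x t.+1 = A t *m x t + B t *m u t + w t) /\
  (forall t : nat, (1 <= t)%N -> t = 1 %[mod H] ->
     exists2 Sigma : 'M[R]_(d + stack H p),
       sdp_optimal alpha Q Rc W A B t Sigma
       & planned_inputs H u t = sdp_gain Sigma *m x t).

(* Main.v *)
(* Write y = a^H, s = sqrt(kappa_W) and c = b kappa_A sqrt(kappa_R / sigma), so
   that kappa_A' = a^(H-1) + c^2 (kappa + y) with kappa >= s^2.

   Let X = Sigma_xx and let M = A~ + B~ K be the closed-loop map of a block. The
   constraints give W <= X <= W / (1 - alpha) and M X M^T <= alpha X, so M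
   contracts the norm sqrt(z^T W^-1 z), which is the same for all blocks, by the
   factor rho. Optimality of Sigma, tested against a perturbation that shrinks M
   along a vector v, shows that K v costs at most as much as any input h with
   B~ h = A~ v; taking h of minimal norm, |K v| <= sqrt(kappa_R / sigma) y |v|
   and |M v| <= c y |v|.

   The coefficient of |x_1| leaves no room for the factor s lost between the two
   norms on top of the transient growth T within a block: one needs
   s T <= a^(H-1) + c^2 (s^2 + y), which follows from T <= 2 c^2 sqrt y. The
   forward estimate T <= (1 + c) a^j gives this at early times j (those with
   a^j <= c sqrt y). At later times the late inputs are too weak to provide the
   controllability constant sigma, so the transition to the end of the block
   expands all directions, and T is bounded by running the block backwards. *)

Require Import Defs.
From HB Require Import structures.
From mathcomp Require Import all_boot all_order all_algebra.
From mathcomp Require Import all_classical all_reals all_analysis.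
From mathcomp Require Import ring lra zify.
Import Order.TTheory GRing.Theory Num.Theory.
Import numFieldNormedType.Exports.
Local Open Scope ring_scope.

Set Implicit Arguments.
Unset Strict Implicit.
Unset Printing Implicit Defensive.

(** * Quadratic forms and norms *)

Section Forms.
Variable R : realType.
Implicit Types n m : nat.

Definition form {n} (M : 'M[R]_n) (u v : 'cV[R]_n) : R := (u^T *m M *m v) 0 0.

Lemma formDl n (M : 'M[R]_n) u1 u2 v :
  form M (u1 + u2) v = form M u1 v + form M u2 v.
Proof. by rewrite /form linearD /= !mulmxDl mxE. Qed.

Lemma formDr n (M : 'M[R]_n) u v1 v2 :
  form M u (v1 + v2) = form M u v1 + form M u v2.
Proof. by rewrite /form mulmxDr mxE. Qed.

Lemma formZl n (M : 'M[R]_n) k u v : form M (k *: u) v = k * form M u v.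
Proof. by rewrite /form linearZ /= -!scalemxAl mxE. Qed.

Lemma formZr n (M : 'M[R]_n) k u v : form M u (k *: v) = k * form M u v.
Proof. by rewrite /form -scalemxAr mxE. Qed.

Lemma formBr n (M : 'M[R]_n) u v1 v2 :
  form M u (v1 - v2) = form M u v1 - form M u v2.
Proof. by rewrite -scaleN1r formDr formZr mulN1r. Qed.

Lemma formBl n (M : 'M[R]_n) u1 u2 v :
  form M (u1 - u2) v = form M u1 v - form M u2 v.
Proof. by rewrite -scaleN1r formDl formZl mulN1r. Qed.

Lemma form_tr n (M : 'M[R]_n) u v : form M^T u v = form M v u.
Proof.
have -> : form M^T u v = (u^T *m M^T *m v)^T 0 0 by rewrite mxE.
by rewrite !trmx_mul !trmxK /form mulmxA.
Qed.

Lemma form_sym n (M : 'M[R]_n) u v : M^T = M -> form M u v = form M v u.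
Proof. by move=> Ms; rewrite -form_tr Ms. Qed.

Lemma formD n (M N : 'M[R]_n) u v : form (M + N) u v = form M u v + form N u v.
Proof. by rewrite /form mulmxDr mulmxDl mxE. Qed.

Lemma formB n (M N : 'M[R]_n) u v : form (M - N) u v = form M u v - form N u v.
Proof. by rewrite /form mulmxBr mulmxBl !mxE. Qed.

Lemma formZ n k (M : 'M[R]_n) u v : form (k *: M) u v = k * form M u v.
Proof. by rewrite /form -scalemxAr -scalemxAl mxE. Qed.

Lemma form_congr m n (F : 'M[R]_(m, n)) (M : 'M[R]_n) u v :
  form (F *m M *m F^T) u v = form M (F^T *m u) (F^T *m v).
Proof. by rewrite /form trmx_mul trmxK !mulmxA. Qed.

Lemma form_mulr n (M N : 'M[R]_n) u v : form M u (N *m v) = form (M *m N) u v.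
Proof. by rewrite /form !mulmxA. Qed.

Lemma form1_mul m n (F : 'M[R]_(m, n)) u v :
  form 1%:M u (F *m v) = form 1%:M (F^T *m u) v.
Proof. by rewrite /form !mulmx1 trmx_mul trmxK mulmxA. Qed.

Lemma form1E n (M : 'M[R]_n) u v : form M u v = form 1%:M u (M *m v).
Proof. by rewrite form_mulr mul1mx. Qed.

Lemma form_scalar n k (u v : 'cV[R]_n) : form k%:M u v = k * form 1%:M u v.
Proof. by rewrite -(scalemx1 _ k) formZ. Qed.

Lemma sym1 n : (1%:M : 'M[R]_n)^T = 1%:M. Proof. exact: trmx1. Qed.

Lemma form1_sum n (u : 'cV[R]_n) : form 1%:M u u = \sum_i u i 0 ^+ 2.
Proof.
by rewrite /form mulmx1 mxE; apply: eq_bigr => i _; rewrite mxE expr2.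
Qed.

Lemma form_psd n (M : 'M[R]_n) u : psd M -> 0 <= form M u u.
Proof. by case=> _; exact. Qed.

Lemma psd1 n : psd (1%:M : 'M[R]_n).
Proof.
split; first exact: sym1.
move=> v; rewrite -/(form _ v v) form1_sum.
by apply: sumr_ge0 => i _; exact: sqr_ge0.
Qed.

Lemma posdef_psd n (M : 'M[R]_n) : posdef M -> psd M.
Proof.
case=> Ms Mp; split=> // v; have [->|v0] := eqVneq v 0.
  by rewrite mulmx0 mxE.
exact/ltW/Mp.
Qed.

(** Nonnegativity of the quadratic polynomial k -> form of u + k v, taken at its minimizer. [M] is
    only semidefinite, so the leading coefficient may vanish. *)
Lemma form_cs n (M : 'M[R]_n) u v :
  psd M -> form M u v ^+ 2 <= form M u u * form M v v.
Proof.
move=> Mp; have Ms := Mp.1.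
have H (k : R) : 0 <= form M u u + 2 * k * form M u v + k ^+ 2 * form M v v.
  have := form_psd (u + k *: v) Mp.
  rewrite formDl !formDr !formZl !formZr (form_sym v u Ms) => h.
  by rewrite (_ : _ + _ = form M u u + k * form M u v
    + (k * form M u v + k * (k * form M v v))) //; ring.
have u0 := form_psd u Mp; have v0 := form_psd v Mp.
have [vz|vn] := eqVneq (form M v v) 0; last first.
  have vp : 0 < form M v v by rewrite lt_neqAle eq_sym vn.
  have := H (- form M u v / form M v v).
  rewrite -(ler_pM2r vp) mul0r.
  set A := form M u u; set B := form M u v; set C := form M v v in vn *.
  rewrite (_ : (_ + _) * C = A * C - B ^+ 2) ?subr_ge0 //; field.
  by [].
rewrite vz mulr0; have [->|B0] := eqVneq (form M u v) 0.
  by rewrite expr0n.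
(* The polynomial is now affine with nonzero slope; this k is where it takes the value -1. *)
have := H (- (form M u u + 1) / (2 * form M u v)); rewrite vz mulr0 addr0.
rewrite (_ : _ + _ = - 1) ?ler0N1 //.
by field.
Qed.

(** * Euclidean norm, spectral norm and condition number *)

Lemma enorm_ge0 n (v : 'cV[R]_n) : 0 <= enorm v.
Proof. exact: sqrtr_ge0. Qed.

Lemma enorm_sqr n (v : 'cV[R]_n) : enorm v ^+ 2 = form 1%:M v v.
Proof.
by rewrite form1_sum sqr_sqrtr // sumr_ge0 // => i _; exact: sqr_ge0.
Qed.

Lemma enorm_le n m (u : 'cV[R]_n) (v : 'cV[R]_m) k :
  0 <= k -> enorm u ^+ 2 <= k ^+ 2 * enorm v ^+ 2 -> enorm u <= k * enorm v.
Proof.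
move=> k0; rewrite -exprMn ler_pXn2r // nnegrE ?enorm_ge0 //.
by rewrite mulr_ge0 ?enorm_ge0.
Qed.

Lemma form1_le n (u v : 'cV[R]_n) : form 1%:M u v <= enorm u * enorm v.
Proof.
apply: le_trans (ler_norm _) _.
rewrite -(ler_pXn2r (n:=2)) // ?nnegrE ?mulr_ge0 ?enorm_ge0 //.
rewrite real_normK ?num_real // exprMn !enorm_sqr.
exact/form_cs/psd1.
Qed.

Lemma enormZ n k (v : 'cV[R]_n) : enorm (k *: v) = `|k| * enorm v.
Proof.
apply/eqP; rewrite -(eqrXn2 (n:=2)) // ?mulr_ge0 ?enorm_ge0 //.
rewrite exprMn !enorm_sqr formZl formZr real_normK ?num_real //.
by apply/eqP; ring.
Qed.

Lemma enorm0 n : enorm (0 : 'cV[R]_n) = 0.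
Proof. by rewrite -(scale0r 0) enormZ normr0 mul0r. Qed.

Lemma enorm_eq0 n (v : 'cV[R]_n) : (enorm v == 0) = (v == 0).
Proof.
apply/idP/idP => [|/eqP->]; last by rewrite enorm0.
rewrite -sqrf_eq0 enorm_sqr form1_sum psumr_eq0; last first.
  by move=> i _; exact: sqr_ge0.
move=> /allP h; apply/eqP/matrixP => i j; rewrite ord1 mxE.
by have := h i (mem_index_enum _); rewrite /= expf_eq0 => /eqP.
Qed.

Lemma enorm_gt0 n (v : 'cV[R]_n) : (0 < enorm v) = (v != 0).
Proof. by rewrite lt_neqAle enorm_ge0 andbT eq_sym enorm_eq0. Qed.

Lemma enormD n (u v : 'cV[R]_n) : enorm (u + v) <= enorm u + enorm v.
Proof.
rewrite -(ler_pXn2r (n:=2)) // ?nnegrE ?addr_ge0 ?enorm_ge0 //.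
rewrite enorm_sqr formDl !formDr (form_sym v u (@sym1 n)) -!enorm_sqr.
have := form1_le u v; nra.
Qed.

Lemma enormN n (v : 'cV[R]_n) : enorm (- v) = enorm v.
Proof. by rewrite -scaleN1r enormZ normrN1 mul1r. Qed.

Lemma enormB n (u v : 'cV[R]_n) : enorm (u - v) <= enorm u + enorm v.
Proof. by apply: le_trans (enormD _ _) _; rewrite enormN. Qed.

Lemma enorm_dim0 n (v : 'cV[R]_n) : n = 0%N -> enorm v = 0.
Proof. by move=> n0; subst n; rewrite flatmx0 enorm0. Qed.

Lemma enorm_sum n (I : Type) (r : seq I) (F : I -> 'cV[R]_n) :
  enorm (\sum_(i <- r) F i) <= \sum_(i <- r) enorm (F i).
Proof.
elim/big_ind2: _ => [|u a v b ua vb|//]; first by rewrite enorm0.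
exact: le_trans (enormD _ _) (lerD ua vb).
Qed.

Lemma entry_le_enorm n (v : 'cV[R]_n) i : `|v i 0| <= enorm v.
Proof.
rewrite -(ler_pXn2r (n:=2)) // ?nnegrE ?enorm_ge0 //.
rewrite real_normK ?num_real // enorm_sqr form1_sum (bigD1 i) //= lerDl.
by apply: sumr_ge0 => j _; exact: sqr_ge0.
Qed.

Lemma mulmx_cols m n (M : 'M[R]_(m, n)) v :
  M *m v = \sum_j v j 0 *: col j M.
Proof.
apply/matrixP => i k; rewrite ord1 mxE summxE.
by apply: eq_bigr => j _; rewrite !mxE mulrC.
Qed.

(** [sup] takes a default value on unbounded sets, so boundedness comes first: entries of a unit
    vector are at most 1, and the column norms add up to a bound. *)
Lemma spnorm_has_sup m n (M : 'M[R]_(m, n)) :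
  has_sup [set enorm (M *m v) | v in [set v : 'cV[R]_n | enorm v <= 1]]%classic.
Proof.
split; first by exists (enorm (M *m 0)), 0 => //=; rewrite enorm0.
exists (\sum_j enorm (col j M)) => _ [v /= v1 <-].
rewrite mulmx_cols; apply: le_trans (enorm_sum _ _) _.
apply: ler_sum => j _; rewrite enormZ ler_piMl ?enorm_ge0 //.
exact: le_trans (entry_le_enorm _ _) v1.
Qed.

Lemma spnorm_ge0 m n (M : 'M[R]_(m, n)) : 0 <= spnorm M.
Proof.
apply: (le_trans (enorm_ge0 (M *m 0))); apply: ub_le_sup.
  by case: (spnorm_has_sup M).
by exists 0 => //=; rewrite enorm0.
Qed.

Lemma enorm_mul m n (M : 'M[R]_(m, n)) v :
  enorm (M *m v) <= spnorm M * enorm v.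
Proof.
have [->|v0] := eqVneq v 0; first by rewrite mulmx0 !enorm0 mulr0.
have vp : 0 < enorm v by rewrite enorm_gt0.
rewrite -ler_pdivrMr //.
have -> : enorm (M *m v) / enorm v = enorm (M *m ((enorm v)^-1 *: v)).
  by rewrite -scalemxAr enormZ mulrC ger0_norm // invr_ge0 ltW.
apply: ub_le_sup; first by case: (spnorm_has_sup M).
exists ((enorm v)^-1 *: v) => //=.
by rewrite enormZ ger0_norm ?invr_ge0 ?enorm_ge0 // mulVf // gt_eqF.
Qed.

Definition opbound m n (M : 'M[R]_(m, n)) k :=
  forall v, enorm (M *m v) <= k * enorm v.

Lemma opbound_spnorm m n (M : 'M[R]_(m, n)) k : spnorm M <= k -> opbound M k.
Proof.
by move=> Mk v; apply: le_trans (enorm_mul M v) _; rewrite ler_wpM2r ?enorm_ge0.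
Qed.

(** For w = M^T v, the square of |w| is the inner product of v and M w, at most |v| k |w|; cancel
    |w|. *)
Lemma opbound_tr m n (M : 'M[R]_(m, n)) k :
  0 <= k -> opbound M k -> opbound M^T k.
Proof.
move=> k0 Mk v; set w := M^T *m v.
have [->|w0] := eqVneq w 0; first by rewrite enorm0 mulr_ge0 ?enorm_ge0.
have wp : 0 < enorm w by rewrite enorm_gt0.
rewrite -(ler_pM2l wp) -expr2 enorm_sqr {2}/w form_sym ?sym1 //.
rewrite -form1_mul; apply: le_trans (form1_le _ _) _.
by have := Mk w; have := enorm_ge0 v; nra.
Qed.

(** Compare a nonzero v with M (M^-1 v). In dimension 0 both norms are 0, whence the hypothesis on
    [n]. *)
Lemma cond_number_ge1 n (M : 'M[R]_n) :
  (0 < n)%N -> M \in unitmx -> 1 <= cond_number M.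
Proof.
move=> n0 Mu; pose v : 'cV[R]_n := const_mx 1.
have vp : 0 < enorm v.
  rewrite enorm_gt0; apply/eqP => /matrixP /(_ (Ordinal n0) 0).
  by rewrite !mxE => /eqP; rewrite oner_eq0.
rewrite -(ler_pM2r vp) mul1r -{1}(mulKVmx Mu v).
apply: le_trans (enorm_mul _ _) _; rewrite -mulrA ler_wpM2l ?spnorm_ge0 //.
exact: enorm_mul.
Qed.

Lemma cond_number_ge0 n (M : 'M[R]_n) : 0 <= cond_number M.
Proof. by rewrite mulr_ge0 ?spnorm_ge0. Qed.

Lemma posdef_unit n (M : 'M[R]_n) : posdef M -> M \in unitmx.
Proof.
case=> Ms Mp; rewrite -row_free_unit -kermx_eq0; apply/eqP/row_matrixP => i.
rewrite row0; apply/eqP; apply: contraT => r0.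
have : (row i (kermx M))^T != 0 by rewrite -trmx0 (inj_eq trmx_inj).
by move/Mp; rewrite trmxK -row_mul mulmx_ker row0 mul0mx mxE ltxx.
Qed.

Lemma invmx_sym n (M : 'M[R]_n) : M^T = M -> (invmx M)^T = invmx M.
Proof. by move=> Ms; rewrite trmx_inv Ms. Qed.

Lemma form_inv n (M : 'M[R]_n) u v : M^T = M -> M \in unitmx ->
  form (invmx M) u v = form M (invmx M *m u) (invmx M *m v).
Proof.
move=> Ms Mu; have E : invmx M = invmx M *m M *m (invmx M)^T.
  by rewrite invmx_sym // mulVmx // mul1mx.
by rewrite {1}E form_congr invmx_sym.
Qed.

Lemma posdef_inv n (M : 'M[R]_n) : posdef M -> psd (invmx M).
Proof.
move=> Mp; have Mu := posdef_unit Mp; have Ms := Mp.1.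
split=> [|v]; first exact: invmx_sym.
by rewrite -/(form _ v v) form_inv //; exact/form_psd/posdef_psd.
Qed.

Lemma form_le_spnorm n (M : 'M[R]_n) v : form M v v <= spnorm M * enorm v ^+ 2.
Proof.
rewrite form1E; apply: le_trans (form1_le _ _) _.
by have := enorm_mul M v; have := enorm_ge0 v; nra.
Qed.

(** Cauchy-Schwarz for the form of [M] between M v and v. Applied to a matrix and to its inverse, it
    compares Euclidean and weighted norms without diagonalization. *)
Lemma enorm_mul_psd n (M : 'M[R]_n) v : psd M ->
  enorm (M *m v) ^+ 2 <= spnorm M * form M v v.
Proof.
move=> Mp; set w := M *m v; have := form_cs w v Mp.
rewrite form1E -/w -enorm_sqr => h; have := le_trans h (ler_wpM2r
  (form_psd v Mp) (form_le_spnorm M w)).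
have [->|w0] := eqVneq w 0.
  by rewrite enorm0 expr0n /= => _; rewrite mulr_ge0 ?spnorm_ge0 ?form_psd.
have wp : 0 < enorm w ^+ 2 by rewrite exprn_gt0 ?enorm_gt0.
by move=> h2; rewrite -(ler_pM2r wp) -expr2 mulrAC.
Qed.

Lemma enorm_le_posdef n (M : 'M[R]_n) v : posdef M ->
  enorm v ^+ 2 <= spnorm (invmx M) * form M v v.
Proof.
move=> Mp; have Mu := posdef_unit Mp.
have := enorm_mul_psd (M *m v) (posdef_inv Mp).
by rewrite mulKmx // form_inv ?Mp.1 // mulKmx.
Qed.

Lemma enorm_le_form_inv n (M : 'M[R]_n) v : posdef M ->
  enorm v ^+ 2 <= spnorm M * form (invmx M) v v.
Proof.
move=> Mp; have Mu := posdef_unit Mp.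
have := enorm_mul_psd (invmx M *m v) (posdef_psd Mp).
by rewrite mulKVmx // -form_inv ?Mp.1.
Qed.

Lemma formD_sqrt n (M : 'M[R]_n) u v : psd M ->
  Num.sqrt (form M (u + v) (u + v)) <=
  Num.sqrt (form M u u) + Num.sqrt (form M v v).
Proof.
move=> Mp; have u0 := form_psd u Mp; have v0 := form_psd v Mp.
rewrite -(ler_pXn2r (n:=2)) // ?nnegrE ?addr_ge0 ?sqrtr_ge0 //.
rewrite sqr_sqrtr ?form_psd // sqrrD !sqr_sqrtr // -sqrtrM //.
rewrite formDl !formDr (form_sym v u Mp.1).
have : form M u v <= Num.sqrt (form M u u * form M v v).
  apply: le_trans (ler_norm _) _; rewrite -sqrtr_sqr.
  by rewrite ler_sqrt ?mulr_ge0 //; exact: form_cs.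
lra.
Qed.

Lemma form_delta n (M : 'M[R]_n) i v :
  form M (delta_mx i 0) v = (M *m v) i 0.
Proof. by rewrite /form trmx_delta -mulmxA -rowE mxE. Qed.

Lemma mulmx_delta n (M : 'M[R]_n) i : M *m delta_mx i 0 = col i M.
Proof. by rewrite colE. Qed.

(* Eliminating a nonzero diagonal entry (a Schur complement) keeps [M] positive
   semidefinite and splits off a rank one term. *)
Lemma mxtrace_psd_ge0 n (M D : 'M[R]_n) : psd M -> psd D -> 0 <= \tr (M *m D).
Proof.
(* Induction on the number of nonzero diagonal entries; with none left, Cauchy-Schwarz forces all
   entries to vanish. *)
have [k] := ubnP #|[pred i | M i i != 0]|.
elim: k M => // k IH M Mk Mp Dp.
have [i /= Mi|M0] := pickP [pred i | M i i != 0]; last first.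
  suff -> : M = 0 by rewrite mul0mx mxtrace0.
  apply/matrixP => i j; rewrite mxE; apply/eqP; rewrite -sqrf_eq0 eq_le sqr_ge0.
  have := form_cs (delta_mx i 0) (delta_mx j 0) Mp.
  rewrite !form_delta !mulmx_delta !mxE andbT.
  by have /negbFE/eqP -> := M0 i; rewrite mul0r.
have Mii : 0 < M i i.
  rewrite lt_neqAle eq_sym Mi /=.
  by have := form_psd (delta_mx i 0) Mp; rewrite form_delta mulmx_delta mxE.
pose c := col i M; pose M' := M - (M i i)^-1 *: (c *m c^T).
have cE v : form M (delta_mx i 0) v = (c^T *m v) 0 0.
  by rewrite form_delta /c tr_col Mp.1 !mxE; apply: eq_bigr => j _; rewrite mxE.
have outer u v : form (c *m c^T) u v = (c^T *m u) 0 0 * (c^T *m v) 0 0.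
  rewrite /form -!mulmxA mulmxA mxE big_ord1; congr (_ * _).
  by rewrite -[u^T *m c]trmxK trmx_mul trmxK mxE.
have M'p : psd M'.
  split; first by rewrite /M' linearB /= linearZ /= trmx_mul trmxK Mp.1.
  move=> v; rewrite -/(form _ v v) formB formZ outer -cE subr_ge0.
  have := form_cs (delta_mx i 0) v Mp.
  rewrite (form_delta _ _ (delta_mx i 0)) mulmx_delta mxE expr2 => h.
  by rewrite -(ler_pM2l Mii) mulVKf // gt_eqF.
have -> : M = M' + (M i i)^-1 *: (c *m c^T) by rewrite subrK.
rewrite mulmxDl linearD /= addr_ge0 //.
  apply: IH => //.
  have lt_k : (#|[predD1 [pred i | M i i != 0%R] & i]| < k)%N.
    by move: Mk; rewrite (cardD1 i) inE /= Mi.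
  apply: leq_ltn_trans lt_k.
  (* The pivot entry becomes 0, and a zero diagonal entry j stays 0 because Cauchy-Schwarz makes the
     (i, j) entry vanish as well. *)
  apply/subset_leq_card/fintype.subsetP => j; rewrite !inE !mxE big_ord1 !mxE.
  have [->|ji] := eqVneq j i; first by rewrite mulKf ?subrr ?eqxx // gt_eqF.
  apply: contra => /eqP Mj /=.
  have := form_cs (delta_mx i 0) (delta_mx j 0) Mp.
  rewrite !form_delta !mulmx_delta !mxE Mj mulr0 => h.
  have Mij : M i j = 0 by apply/eqP; rewrite -sqrf_eq0 eq_le h sqr_ge0.
  have -> : M j i = M i j by rewrite -{1}Mp.1 mxE.
  by rewrite Mij !mulr0 subr0.
rewrite -scalemxAl linearZ /= mulr_ge0 ?invr_ge0 ?(ltW Mii) //.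
rewrite -mulmxA mxtrace_mulC /mxtrace big_ord1 ord1; exact: (form_psd c Dp).
Qed.

(** * Discrete Lyapunov equation *)

Lemma le0_geometric (a x C : R) : 0 <= a < 1 ->
  (forall k, x <= C * a ^+ k) -> x <= 0.
Proof.
move=> /andP[a0 a1] h.
have hc : (geometric C a n @[n --> \oo] --> (0 : R))%classic.
  by apply: cvg_geometric; rewrite ger0_norm.
apply: (cvgr_to_ge hc); apply: nearW => k; exact: h.
Qed.

Lemma form_ext m (D : 'M[R]_m) : (forall u v, form D u v = 0) -> D = 0.
Proof.
move=> h; apply/matrixP => i j.
by have := h (delta_mx i 0) (delta_mx j 0); rewrite form_delta mulmx_delta !mxE.
Qed.

Section Lyapunov.
Variables (n : nat) (N X : 'M[R]_n) (a : R).
Hypotheses (Xp : posdef X) (a01 : 0 <= a < 1).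
Hypothesis contr : forall w, form X (N^T *m w) (N^T *m w) <= a * form X w w.

(** Along the orbit of w under N^T the form of -D does not decrease, while it is at most C times the
    form of [X], which decays like a^k. Hence it is at most 0 at the start. *)
Lemma lyapunov_psd (D : 'M[R]_n) : D^T = D ->
  (forall w, form D (N^T *m w) (N^T *m w) <= form D w w) -> psd D.
Proof.
move=> Ds Dle; split=> // v; rewrite -/(form _ v v).
pose C := spnorm (- D) * spnorm (invmx X).
have C0 : 0 <= C by rewrite mulr_ge0 ?spnorm_ge0.
have X0 w : 0 <= form X w w by exact/form_psd/posdef_psd.
have DC k w : - form D w w <= C * a ^+ k * form X w w.
  elim: k w => [|k IH] w.
    rewrite expr0 mulr1.
    have := form_le_spnorm (- D) w; have := enorm_le_posdef w Xp.
    rewrite -scaleN1r formZ mulN1r scaleN1r -mulrA => h1 h2.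
    apply: le_trans h2 _; by rewrite ler_wpM2l ?spnorm_ge0.
  have h := IH (N^T *m w); have h1 := Dle w; have h2 := contr w.
  have Ca : 0 <= C * a ^+ k by rewrite mulr_ge0 ?exprn_ge0; case/andP: a01.
  have h3 := ler_wpM2l Ca h2.
  rewrite exprSr; rewrite -!mulrA in h h3 *; lra.
rewrite -oppr_le0; apply: (le0_geometric (C := C * form X v v) a01) => k.
by rewrite mulrAC.
Qed.

(** Iterating the equation k times moves both arguments k steps along N^T, where the contraction
    makes the value O(a^k). The bound is kept squared to use Cauchy-Schwarz without roots. *)
Lemma lyapunov_inj (D : 'M[R]_n) : D = N *m D *m N^T -> D = 0.
Proof.
move=> DE; pose C := spnorm D * spnorm (invmx X).
have C0 : 0 <= C by rewrite mulr_ge0 ?spnorm_ge0.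
have [a0 a1] := andP a01.
have X0 w : 0 <= form X w w by exact/form_psd/posdef_psd.
have Dk k u v : form D u v ^+ 2 <=
    C ^+ 2 * (a ^+ 2) ^+ k * (form X u u * form X v v).
  elim: k u v => [|k IH] u v.
    rewrite expr0 mulr1; have hu := enorm_le_posdef u Xp.
    have hv := enorm_le_posdef v Xp; have hd := enorm_mul D v.
    rewrite form1E; apply: le_trans (form_cs _ _ (psd1 _)) _.
    rewrite -!enorm_sqr.
    have hd2 : enorm (D *m v) ^+ 2 <= spnorm D ^+ 2 * enorm v ^+ 2.
      by rewrite -exprMn ler_pXn2r ?nnegrE ?mulr_ge0 ?spnorm_ge0 ?enorm_ge0.
    apply: le_trans (ler_wpM2l (sqr_ge0 _) hd2) _.
    rewrite mulrCA.
    apply: le_trans (ler_wpM2l (sqr_ge0 _)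
      (ler_pM (sqr_ge0 _) (sqr_ge0 _) hu hv)) _.
    by rewrite le_eqVlt; apply/orP; left; apply/eqP; rewrite /C; ring.
  rewrite {1}DE form_congr; apply: le_trans (IH _ _) _.
  have Cak : 0 <= C ^+ 2 * (a ^+ 2) ^+ k by rewrite mulr_ge0 ?exprn_ge0.
  apply: le_trans (ler_wpM2l Cak (ler_pM (X0 _) (X0 _) (contr u) (contr v))) _.
  by rewrite le_eqVlt; apply/orP; left; apply/eqP; rewrite (exprSr (a ^+ 2)); ring.
apply: form_ext => u v; apply/eqP; rewrite -sqrf_eq0 eq_le sqr_ge0 andbT.
apply: (le0_geometric (a := a ^+ 2) (C := C ^+ 2 * (form X u u * form X v v))).
  by rewrite sqr_ge0 expr_lt1.
by move=> k; rewrite mulrAC.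
Qed.

(** Y - N Y N^T is an injective endomorphism of a finite-dimensional space, hence surjective. The
    transpose of a solution solves the same equation, so injectivity also gives symmetry. *)
Lemma lyapunov_solution (V : 'M[R]_n) : V^T = V ->
  exists2 Y : 'M[R]_n, Y^T = Y & Y = N *m Y *m N^T + V.
Proof.
move=> Vs; pose f (Y : 'M[R]_n) := Y - N *m Y *m N^T.
have f_lin : linear f.
  move=> k Y Z; rewrite /f mulmxDr mulmxDl -scalemxAr -scalemxAl.
  by rewrite scalerBr addrACA opprD.
pose fM := GRing.isLinear.Build _ _ _ _ f f_lin.
pose fL : {linear _ -> _} := HB.pack f fM.
have g_unit : lin_mx fL \in unitmx.
  rewrite -row_free_unit -kermx_eq0; apply/eqP/row_matrixP => i; rewrite row0.
  have : row i (kermx (lin_mx fL)) *m lin_mx fL = 0.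
    by rewrite -row_mul mulmx_ker row0.
  rewrite mul_rV_lin => /eqP; rewrite mxvec_eq0 => /eqP h.
  apply/eqP; rewrite -vec_mx_eq0; apply/eqP/lyapunov_inj/eqP.
  by rewrite -subr_eq0; apply/eqP.
pose Y := vec_mx (mxvec V *m invmx (lin_mx fL)).
have YE : Y - N *m Y *m N^T = V.
  rewrite -[LHS]/(fL Y) -[LHS]mxvecK -mul_vec_lin /Y vec_mxK mulmxKV //.
  exact: mxvecK.
exists Y; last by rewrite -[X in _ + X]YE addrC subrK.
apply/eqP; rewrite -subr_eq0; apply/eqP/lyapunov_inj.
have YtE : Y^T - N *m Y^T *m N^T = V.
  by rewrite -Vs -YE linearB /= !trmx_mul trmxK mulmxA.
apply/eqP; rewrite -subr_eq0 mulmxBr mulmxBl opprB [X in _ + X]addrC addrACA.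
by rewrite YtE [- Y + _]addrC -opprB YE subrr.
Qed.
End Lyapunov.
End Forms.

(** * Optimality in the semidefinite program *)

Section Joint.
Variables (R : realType) (d m : nat).
Implicit Types (X Q W A : 'M[R]_d) (K : 'M[R]_(m, d)) (D U : 'M[R]_m).
Implicit Types (B : 'M[R]_(d, m)).

(* The covariance of (x, K x + e) when x has covariance X and the independent
   noise e has covariance D. *)
Definition joint X K D : 'M[R]_(d + m) :=
  block_mx X (X *m K^T) (K *m X) (K *m X *m K^T + D).

Lemma joint_tr X K D : X^T = X -> D^T = D -> (joint X K D)^T = joint X K D.
Proof.
move=> Xs Ds; rewrite /joint tr_block_mx !linearD /= !trmx_mul !trmxK Xs Ds.
by rewrite mulmxA.
Qed.

Lemma form_joint X K D p q : X^T = X ->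
  form (joint X K D) (col_mx p q) (col_mx p q)
    = form X (p + K^T *m q) (p + K^T *m q) + form D q q.
Proof.
move=> Xs; rewrite formDl !formDr -form_congr.
rewrite (form_sym (K^T *m q) p Xs).
rewrite {1}/form /joint tr_col_mx mul_row_block mul_row_col !mulmxDl.
rewrite mxE [X in X + _ = _]mxE [X in _ + X = _]mxE.
have -> : (p^T *m (X *m K^T) *m q) 0 0 = form X p (K^T *m q).
  by rewrite /form !mulmxA.
have -> : (q^T *m (K *m X) *m p) 0 0 = form X p (K^T *m q).
  by rewrite form_sym // /form trmx_mul trmxK !mulmxA.
have -> : (q^T *m (K *m X *m K^T + D) *m q) 0 0
    = form (K *m X *m K^T) q q + form D q q by rewrite -formD.
rewrite -/(form X p p); ring.
Qed.

Lemma psd_joint X K D : psd X -> psd D -> psd (joint X K D).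
Proof.
move=> Xp Dp; split; first by rewrite joint_tr ?Xp.1 ?Dp.1.
move=> v; rewrite -(vsubmxK v) -/(form _ _ _) form_joint ?Xp.1 //.
by rewrite addr_ge0 ?form_psd.
Qed.

(** The noise covariance [D] is the Schur complement of the state block; testing [S] on (- K^T q, q)
    removes the state term and leaves the form of [D] at q. *)
Lemma psdE_joint (S : 'M[R]_(d + m)) : psd S -> posdef (ulsubmx S) ->
  exists2 D, psd D &
    S = joint (ulsubmx S) ((ursubmx S)^T *m invmx (ulsubmx S)) D.
Proof.
move=> Sp Xp; set X := ulsubmx S in Xp *; set K := _ *m _.
have Xu := posdef_unit Xp; have Xs := Xp.1.
have KX : K *m X = (ursubmx S)^T by rewrite mulmxKV.
move: K KX => K KX.
have XK : X *m K^T = ursubmx S by rewrite -[RHS]trmxK -KX trmx_mul Xs.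
have SE : S = joint X K (drsubmx S - K *m X *m K^T).
  by rewrite /joint addrC subrK XK KX trmx_ursub Sp.1 submxK.
exists (drsubmx S - K *m X *m K^T) => //; split.
  by rewrite linearB /= !trmx_mul trmxK Xs trmx_drsub Sp.1 mulmxA.
have Jp : psd (joint X K (drsubmx S - K *m X *m K^T)) by rewrite -SE.
move=> q; have := form_psd (col_mx (- (K^T *m q)) q) Jp.
by rewrite form_joint // addNr /form mulmx0 [X in X + _]mxE add0r.
Qed.

Lemma propagated_joint A B X K D :
  row_mx A B *m joint X K D *m (row_mx A B)^T
    = (A + B *m K) *m X *m (A + B *m K)^T + B *m D *m B^T.
Proof.
rewrite /joint mul_row_block tr_row_mx mul_row_col.
rewrite [(A + _)^T]linearD /= [(B *m K)^T]trmx_mul.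
by rewrite !(mulmxDl, mulmxDr) !mulmxA -!addrA.
Qed.

Lemma cost_joint Q (Rt : 'M[R]_m) X K D : Q^T = Q -> Rt^T = Rt ->
  mxinner (block_mx Q 0 0 Rt) (joint X K D)
    = \tr (Q *m X) + \tr (Rt *m (K *m X *m K^T)) + \tr (Rt *m D).
Proof.
move=> Qs Rs; rewrite /mxinner tr_block_mx Qs Rs !trmx0 mulmx_block.
by rewrite mxtrace_block !mul0mx addr0 add0r mulmxDr linearD /= addrA.
Qed.

End Joint.

Lemma psd_congr (R : realType) m n (F : 'M[R]_(m, n)) (N : 'M[R]_n) :
  psd N -> psd (F *m N *m F^T).
Proof.
move=> Np; split; first by rewrite !trmx_mul trmxK Np.1 mulmxA.
by move=> v; rewrite -/(form _ v v) form_congr form_psd.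
Qed.

Lemma mxtrace_outer (R : realType) n (N : 'M[R]_n) p q :
  \tr (N *m (p *m q^T)) = form N q p.
Proof. by rewrite mulmxA mxtrace_mulC mulmxA /mxtrace big_ord1 ord1. Qed.

(** * First-order condition satisfied by an optimal gain *)

Section OptimalGain.
Variables (R : realType) (d m : nat).
Variables (A W Q X : 'M[R]_d) (B : 'M[R]_(d, m)) (K : 'M[R]_(m, d)).
Variables (D Rt : 'M[R]_m) (alpha : R).
Hypotheses (Wp : posdef W) (Qp : psd Q) (Rp : psd Rt).
Hypothesis a01 : 0 <= alpha < 1.
Hypotheses (Xp : posdef X) (Dp : psd D).
Let M := A + B *m K.
Hypothesis XE : X = M *m X *m M^T + B *m D *m B^T + W.
Hypothesis Xa : loewner_le (M *m X *m M^T + B *m D *m B^T) (alpha *: X).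
Hypothesis opt : forall X' K' D',
  let P' := (A + B *m K') *m X' *m (A + B *m K')^T + B *m D' *m B^T in
  psd X' -> psd D' -> X' = P' + W -> loewner_le P' (alpha *: X') ->
  \tr (Q *m X) + \tr (Rt *m (K *m X *m K^T)) + \tr (Rt *m D) <=
  \tr (Q *m X') + \tr (Rt *m (K' *m X' *m K'^T)) + \tr (Rt *m D').

Let Xs : X^T = X. Proof. exact: Xp.1. Qed.
Let Xu : X \in unitmx. Proof. exact: posdef_unit. Qed.

Lemma form_noise w : 0 <= form (B *m D *m B^T) w w.
Proof. by rewrite form_congr form_psd. Qed.

Lemma form_gain_le w : form X (M^T *m w) (M^T *m w) <= alpha * form X w w.
Proof.
have := form_psd w Xa; rewrite formB formD formZ (form_congr M X).
have := form_noise w; lra.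
Qed.

(* Shrinking the closed-loop map along [v] by the input [- e g] keeps the
   program feasible, since the stationary covariance can only decrease. *)
Lemma optimal_gain_le0 v g : B *m g = M *m v -> form Rt g (K *m v) <= 0.
Proof.
move=> gE; rewrite leNgt; apply/negP; set G := form Rt g (K *m v) => G0.
have [tau tauE] : {t | form (invmx X) v v = t} by eexists.
have [gam gamE] : {t | form Rt g g = t} by eexists.
have tau0 : 0 <= tau by rewrite -tauE; apply: form_psd; exact: posdef_inv.
have gam0 : 0 <= gam by rewrite -gamE; exact: form_psd.
(* The first condition keeps 2 e - e^2 tau nonnegative, so the closed-loop map shrinks; the second
   makes the cost change - 2 e G + e^2 tau gam negative. *)
have [e e0 [etau egam]] : exists2 e, 0 < e & e * tau <= 1 /\ e * tau * gam < 2 * G.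
  have tg0 := mulr_ge0 tau0 gam0; have Gt0 := mulr_ge0 (ltW G0) tau0.
  have [den denE] : {t | G + G * tau + tau * gam = t} by eexists.
  have den0 : 0 < den by lra.
  have eden : G / den * den = G by rewrite divfK // gt_eqF.
  exists (G / den); first exact: divr_gt0.
  split; first by rewrite -(ler_pM2r den0) mulrAC eden; lra.
  rewrite -(ltr_pM2r den0) -mulrA mulrAC eden.
  have := mulr_gt0 G0 G0; have := mulr_ge0 (ltW G0) tg0.
  by have := mulr_ge0 (ltW G0) Gt0; rewrite -denE; lra.
(* A rank one change: the functional v^T X^-1 confines it to the direction of v with respect to [X],
   so cross terms reduce to tau and G. *)
pose K' := K - e *: (g *m (v^T *m invmx X)).
pose M' := A + B *m K'.
have M'E : M' = M - e *: ((M *m v) *m (v^T *m invmx X)).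
  by rewrite /M' /K' mulmxBr -scalemxAr (mulmxA B) gE addrA.
have M'tr w : M'^T *m w = M^T *m w - (e * form 1%:M w (M *m v)) *: (invmx X *m v).
  rewrite M'E linearB linearZ /= !trmx_mul (invmx_sym Xs) trmxK mulmxBl.
  congr (_ - _); rewrite -scalemxAl -!scalerA; congr (_ *: _).
  rewrite -trmx_mul -!mulmxA mulmxA [X in _ *m X]mx11_scalar mul_mx_scalar.
  by rewrite form_sym ?sym1 // /form mulmx1.
have M'X w : form X (M'^T *m w) (M'^T *m w) = form X (M^T *m w) (M^T *m w)
    - (2 * e - e ^+ 2 * tau) * form 1%:M w (M *m v) ^+ 2.
  rewrite M'tr !(formBl, formBr, formZl, formZr).
  have h1 z : form X z (invmx X *m v) = form 1%:M z v.
    by rewrite form_mulr mulmxV.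
  rewrite (form_sym (invmx X *m v) (M^T *m w) Xs) !h1 -form1_mul.
  have -> : form 1%:M (invmx X *m v) v = tau.
    by rewrite form_sym ?sym1 // -tauE form_mulr mul1mx.
  ring.
have M'le w : form X (M'^T *m w) (M'^T *m w) <= form X (M^T *m w) (M^T *m w).
  rewrite M'X gerBl mulr_ge0 ?sqr_ge0 //; nra.
have contr w : form X (M'^T *m w) (M'^T *m w) <= alpha * form X w w.
  exact: le_trans (M'le w) (form_gain_le w).
pose V := B *m D *m B^T + W.
have Vs : V^T = V by rewrite /V linearD /= !trmx_mul trmxK Dp.1 Wp.1 mulmxA.
(* [Y] is the stationary covariance for the new gain with the same noise. *)
have [Y Ys YE] := lyapunov_solution Xp a01 contr Vs.
have YX : psd (X - Y).
  apply: (lyapunov_psd Xp a01 contr) => [|w]; first by rewrite linearB /= Xs Ys.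
  rewrite !formB -(form_congr M' Y).
  have -> : form Y w w = form (M' *m Y *m M'^T) w w + form V w w.
    by rewrite -formD -YE.
  have -> : form X w w = form X (M^T *m w) (M^T *m w) + form V w w.
    by rewrite {1}XE -addrA formD form_congr.
  by have := M'le w; lra.
have Yp : psd Y.
  apply: (lyapunov_psd Xp a01 contr) => // w.
  have -> : form Y w w = form (M' *m Y *m M'^T) w w + form V w w.
    by rewrite -formD -YE.
  rewrite form_congr lerDl /V formD addr_ge0 ?form_noise //.
  exact/form_psd/posdef_psd.
have PE : Y = M' *m Y *m M'^T + B *m D *m B^T + W by rewrite -addrA -/V -YE.
(* Given the first constraint, the third one reads (1 - alpha) Y <= W, so it passes from [X] down to
   the smaller [Y]. *)
have YW : loewner_le (M' *m Y *m M'^T + B *m D *m B^T) (alpha *: Y).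
  have -> : M' *m Y *m M'^T + B *m D *m B^T = Y - W by rewrite {2}PE addrK.
  split; first by rewrite !linearB /= linearZ /= Ys Wp.1.
  move=> w; rewrite -/(form _ w w) !formB formZ.
  have := form_psd w Xa; rewrite formB formZ.
  have -> : M *m X *m M^T + B *m D *m B^T = X - W by rewrite {2}XE addrK.
  have := form_psd w YX; rewrite !formB; have /andP[_ a1] := a01.
  by nra.
have := @opt Y K' D Yp Dp PE YW.
have trQ := mxtrace_psd_ge0 Qp YX; rewrite mulmxBr linearB /= in trQ.
have trR : \tr (Rt *m (K' *m Y *m K'^T)) <= \tr (Rt *m (K' *m X *m K'^T)).
  rewrite -subr_ge0 -linearB -mulmxBr -mulmxBl -mulmxBr /=.
  exact/mxtrace_psd_ge0/psd_congr.
have trK : \tr (Rt *m (K' *m X *m K'^T)) =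
    \tr (Rt *m (K *m X *m K^T)) - 2 * e * G + e ^+ 2 * tau * gam.
  have -> : K' *m X *m K'^T = K *m X *m K^T
      - e *: (K *m v *m g^T + g *m (K *m v)^T) + (e ^+ 2 * tau) *: (g *m g^T).
    pose r := v^T *m invmx X.
    have rX : r *m X = v^T by rewrite mulmxKV.
    have Xr : X *m r^T = v by rewrite -{1}Xs -trmx_mul rX trmxK.
    have vr : v^T *m r^T = tau%:M.
      by rewrite trmx_mul trmxK (invmx_sym Xs) mulmxA [LHS]mx11_scalar -tauE.
    have K'X : K' *m X = K *m X - e *: (g *m v^T).
      by rewrite /K' -/r mulmxBl -scalemxAl -mulmxA rX.
    have K'tr : K'^T = K^T - e *: (r^T *m g^T).
      by rewrite /K' -/r linearB linearZ /= trmx_mul.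
    rewrite K'X K'tr mulmxBr !mulmxBl -!(scalemxAl, scalemxAr) scalerA.
    have -> : K *m X *m (r^T *m g^T) = K *m v *m g^T.
      by rewrite mulmxA -(mulmxA K) Xr.
    have -> : g *m v^T *m (r^T *m g^T) = tau *: (g *m g^T).
      by rewrite mulmxA -(mulmxA g) vr mul_mx_scalar -scalemxAl.
    rewrite scalerA -expr2 trmx_mul mulmxA scalerDr opprB opprD.
    by rewrite [_ *: (g *m g^T) - _]addrC !addrA [X in X + _ = _]addrAC.
  rewrite mulmxDr mulmxBr -!scalemxAr mulmxDr linearD linearB !linearZ linearD /=.
  rewrite !mxtrace_outer gamE (form_sym (K *m v) g Rp.1) -/G.
  by rewrite /GRing.scale /=; ring.
move: etau egam e0; rewrite trK in trR; nra.
Qed.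
End OptimalGain.

(** * Stacked inputs, block by block *)

Section Stack.
Variables (R : realType) (p H : nat).

Lemma form_stack (N : 'M[R]_p) (u v : 'cV[R]_(stack H p)) :
  form (lifted_R H N) u v = \sum_j form N (submxcol u j) (submxcol v j).
Proof.
rewrite -{1}(submxcolK u) -{1}(submxcolK v) /form /lifted_R.
rewrite -mulmxA mul_mxdiag_mxcol tr_mxcol mul_mxrow_mxcol summxE.
by apply: eq_bigr => j _; rewrite mulmxA.
Qed.

Lemma enorm_stack (u : 'cV[R]_(stack H p)) :
  enorm u ^+ 2 = \sum_j enorm (submxcol u j) ^+ 2.
Proof.
have -> : enorm u ^+ 2 = form (lifted_R H 1%:M) u u.
  by rewrite enorm_sqr /lifted_R mxdiagZ.
by rewrite form_stack; apply: eq_bigr => j _; rewrite enorm_sqr.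
Qed.

Lemma enorm_submxcol (u : 'cV[R]_(stack H p)) j : enorm (submxcol u j) <= enorm u.
Proof.
rewrite -(ler_pXn2r (n:=2)) // ?nnegrE ?enorm_ge0 // enorm_stack.
by rewrite (bigD1 j) //= lerDl sumr_ge0 // => i _; exact: sqr_ge0.
Qed.

Lemma psd_stack (N : 'M[R]_p) : psd N -> psd (lifted_R H N).
Proof.
move=> Np; split.
  by rewrite /lifted_R tr_mxdiag; apply: eq_mxdiag => j; exact: Np.1.
move=> v; rewrite -/(form _ v v) form_stack.
by apply: sumr_ge0 => j _; exact: form_psd.
Qed.

Lemma form_stack_le (N : 'M[R]_p) (u : 'cV[R]_(stack H p)) :
  form (lifted_R H N) u u <= spnorm N * enorm u ^+ 2.
Proof.
rewrite form_stack enorm_stack mulr_sumr.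
by apply: ler_sum => j _; exact: form_le_spnorm.
Qed.

Lemma enorm_le_stack (N : 'M[R]_p) (u : 'cV[R]_(stack H p)) : posdef N ->
  enorm u ^+ 2 <= spnorm (invmx N) * form (lifted_R H N) u u.
Proof.
move=> Np; rewrite form_stack enorm_stack mulr_sumr.
by apply: ler_sum => j _; exact: enorm_le_posdef.
Qed.

End Stack.

(** The minimal-norm solution is h = B^T q with q = (B B^T)^-1 y. The square of |h| is the inner
    product of q and y, and sigma |q|^2 <= |h|^2. *)
Lemma loewner_right_inverse (R : realType) d m (B : 'M[R]_(d, m)) sigma y :
  0 < sigma -> loewner_le sigma%:M (B *m B^T) ->
  exists2 h, B *m h = y & sigma * enorm h ^+ 2 <= enorm y ^+ 2.
Proof.
move=> s0 Bs.
have Bge v : sigma * enorm v ^+ 2 <= form (B *m B^T) v v.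
  have := form_psd v Bs; rewrite formB form_scalar -enorm_sqr subr_ge0; exact.
have Bp : posdef (B *m B^T).
  split=> [|v v0]; first by rewrite trmx_mul trmxK.
  apply: lt_le_trans (Bge v); by rewrite mulr_gt0 // exprn_gt0 ?enorm_gt0.
have Bu := posdef_unit Bp; pose q := invmx (B *m B^T) *m y.
have qE : B *m (B^T *m q) = y by rewrite mulmxA mulKVmx.
exists (B^T *m q) => //.
have hq : enorm (B^T *m q) ^+ 2 = form 1%:M q y.
  by rewrite enorm_sqr -form1_mul qE.
have hq2 : enorm (B^T *m q) ^+ 2 = form (B *m B^T) q q.
  by rewrite enorm_sqr -(form_congr B 1%:M) mulmx1.
have h1 := Bge q; rewrite -hq2 in h1.
have h2 := form1_le q y; rewrite -hq in h2.
have h3 : enorm (B^T *m q) ^+ 4 <= enorm q ^+ 2 * enorm y ^+ 2.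
  rewrite -exprMn (exprM _ 2 2) ler_pXn2r // nnegrE ?sqr_ge0 //.
  by rewrite mulr_ge0 ?enorm_ge0.
have [h0|h0] := eqVneq (enorm (B^T *m q)) 0.
  by rewrite h0 expr0n mulr0 sqr_ge0.
have hp : 0 < enorm (B^T *m q) ^+ 2 by rewrite exprn_even_gt0.
rewrite -(ler_pM2r hp) -mulrA -expr2 -exprM.
apply: le_trans (ler_wpM2l (ltW s0) h3) _.
rewrite mulrA mulrC ler_wpM2l ?sqr_ge0 //.
Qed.

(** Duality: with q = W^-1 M z, the left side b is the [W]-product of M^T q and W^-1 z, so
    Cauchy-Schwarz gives b^2 <= r b c, where c is the form at z. *)
Lemma contraction_dual (R : realType) d (W M : 'M[R]_d) (r : R) : posdef W ->
  0 <= r -> (forall w, form W (M^T *m w) (M^T *m w) <= r * form W w w) ->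
  forall z, form (invmx W) (M *m z) (M *m z) <= r * form (invmx W) z z.
Proof.
move=> Wp r0 h z; have Wu := posdef_unit Wp; have Ws := Wp.1.
set b := form _ (M *m z) _; set c := form _ z z.
have b0 : 0 <= b by exact/form_psd/posdef_inv.
have c0 : 0 <= c by exact/form_psd/posdef_inv.
pose q := invmx W *m (M *m z).
have bq : b = form W q q by rewrite /b form_inv.
have bE : b = form W (M^T *m q) (invmx W *m z).
  rewrite form_mulr mulmxV // -form1_mul form_sym ?sym1 // -/q.
  by rewrite form_mulr mul1mx.
have := form_cs (M^T *m q) (invmx W *m z) (posdef_psd Wp).
rewrite -bE -form_inv // -/c => h1.
have h2 := le_trans h1 (ler_wpM2r c0 (h q)); rewrite -bq in h2.
have [->|bn] := eqVneq b 0; first by rewrite mulr_ge0.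
have bp : 0 < b by rewrite lt_neqAle eq_sym bn.
by rewrite -(ler_pM2r bp) -expr2 mulrAC.
Qed.

(** * Consequences of optimality for one block *)

Section OptimalBlock.
Variables (R : realType) (d p H : nat) (Q W : 'M[R]_d) (Rc : 'M[R]_p).
Variables (alpha : R) (A : nat -> 'M[R]_d) (B : nat -> 'M[R]_(d, p)) (t : nat).
Variable S : 'M[R]_(d + stack H p).
Hypotheses (Qp : posdef Q) (Rp : posdef Rc) (Wp : posdef W).
Hypothesis a01 : 0 <= alpha < 1.
Hypothesis Sopt : sdp_optimal alpha Q Rc W A B t S.

Let K := sdp_gain S.
Let M := lifted_A H A t + lifted_B H A B t *m K.
Let X := ulsubmx S.

(** First part: M^T contracts [X] by alpha, and W <= X <= W / (1 - alpha) transfers this to [W] at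
    the price of the factor 1 / (1 - alpha); duality then passes to [M]. Second part: every [joint]
    built from feasible data competes with [S]. *)
Lemma optimal_block_facts :
  (forall z, form (invmx W) (M *m z) (M *m z)
     <= alpha / (1 - alpha) * form (invmx W) z z) /\
  (forall v g, lifted_B H A B t *m g = M *m v ->
     form (lifted_R H Rc) g (K *m v) <= 0).
Proof.
have [[XE Sp Xa] Sbest] := Sopt; have [a0 a1] := andP a01.
have P0 w : 0 <= form (propagated A B t S) w w.
  by rewrite /propagated /= form_congr form_psd.
have XW w : form W w w <= form X w w.
  by rewrite /X XE formD lerDr.
have Xp : posdef X.
  split=> [|w w0]; first by rewrite /X trmx_ulsub Sp.1.
  by apply: lt_le_trans (XW w); exact: Wp.2.
have [D Dp SE] := psdE_joint Sp Xp; rewrite -/X -/K in SE.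
have PE : propagated A B t S =
    M *m X *m M^T + lifted_B H A B t *m D *m (lifted_B H A B t)^T.
  by rewrite /propagated SE propagated_joint.
rewrite PE in XE Xa; rewrite -/X in XE Xa.
split.
  apply: contraction_dual => //; first by rewrite divr_ge0 // subr_ge0 ltW.
  move=> w; have h1 := form_gain_le Dp Xa w.
  have h2 : (1 - alpha) * form X w w <= form W w w.
    have := form_psd w Xa; rewrite formB formZ.
    have -> : M *m X *m M^T + lifted_B H A B t *m D *m (lifted_B H A B t)^T
      = X - W by rewrite {2}XE addrK.
    by rewrite formB; nra.
  rewrite mulrAC ler_pdivlMr ?subr_gt0 //.
  apply: le_trans (_ : (1 - alpha) * (alpha * form X w w) <= _).
    rewrite mulrC ler_wpM2l ?subr_ge0 ?(ltW a1) //.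
    exact: le_trans (XW _) h1.
  by rewrite mulrCA ler_wpM2l.
apply: (optimal_gain_le0 (A := lifted_A H A t) (X := X) (D := D) (alpha := alpha)
  Wp (posdef_psd Qp) (psd_stack H (posdef_psd Rp)) a01 Xp Dp XE Xa).
move=> X' K' D' P' X'p D'p X'E X'a.
have := Sbest (joint X' K' D'); rewrite /sdp_cost {1}SE.
rewrite !cost_joint ?Qp.1 ?(psd_stack H (posdef_psd Rp)).1 //; apply.
rewrite /sdp_feasible /propagated /= propagated_joint block_mxKul.
by split=> //; exact: psd_joint.
Qed.

(* The test direction of [optimal_gain_le0] is g = K v + h. *)
Lemma optimal_input_le v h : lifted_B H A B t *m h = lifted_A H A t *m v ->
  let Rt := lifted_R H Rc in
  form Rt (K *m v) (K *m v) <= form Rt h h /\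
  form Rt (K *m v + h) (K *m v + h) <= form Rt h h.
Proof.
move=> hE Rt; have Rtp : psd Rt := psd_stack H (posdef_psd Rp).
have := optimal_block_facts.2 v (K *m v + h).
rewrite mulmxDr hE mulmxA -mulmxDl addrC => /(_ erefl).
have := form_psd (K *m v + h) Rtp; have := form_psd (K *m v) Rtp.
rewrite !formDl !formDr (form_sym (K *m v) h Rtp.1) -/Rt.
lra.
Qed.

End OptimalBlock.

(** * Dynamics within a block *)

Section GeometricSum.
Variables (R : realType) (a : R).

Definition geosum n : R := \sum_(i < n) a ^+ i.

Lemma geosum0 : geosum 0 = 0. Proof. by rewrite /geosum big_ord0. Qed.

Lemma geosumSr n : geosum n.+1 = geosum n + a ^+ n.
Proof. by rewrite /geosum big_ord_recr. Qed.

Lemma geosumS n : geosum n.+1 = a * geosum n + 1.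
Proof.
rewrite /geosum big_ord_recl expr0 addrC mulr_sumr; congr (_ + _).
by apply: eq_bigr => i _; rewrite exprS.
Qed.

Lemma geosumD j m : geosum (j + m) = geosum m + a ^+ m * geosum j.
Proof.
elim: m => [|m IH]; first by rewrite addn0 geosum0 expr0 add0r mul1r.
by rewrite addnS !geosumS IH exprS; ring.
Qed.

(** The closed form of the sum, multiplied out so that a = 1 is included. *)
Lemma geosumE n : a ^+ n = 1 + (a - 1) * geosum n.
Proof.
elim: n => [|n IH]; first by rewrite expr0 geosum0 mulr0 addr0.
by rewrite exprS IH geosumS; ring.
Qed.

Hypothesis a0 : 0 <= a.

Lemma geosum_ge0 n : 0 <= geosum n.
Proof. by apply: sumr_ge0 => i _; exact: exprn_ge0. Qed.

Lemma geosum_ge1 n : (0 < n)%N -> 1 <= geosum n.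
Proof.
by case: n => // n _; rewrite geosumS lerDr mulr_ge0 // geosum_ge0.
Qed.

Lemma geosum_le m n : (m <= n)%N -> geosum m <= geosum n.
Proof.
move=> mn; rewrite -(subnK mn) geosumD lerDl.
by rewrite mulr_ge0 ?exprn_ge0 ?geosum_ge0.
Qed.

End GeometricSum.

Section Dynamics.
Variables (R : realType) (d p : nat).
Variables (A : nat -> 'M[R]_d) (B : nat -> 'M[R]_(d, p)).

Fixpoint response (f : nat -> 'cV[R]_d) (t n : nat) : 'cV[R]_d :=
  if n is k.+1 then A (t + k)%N *m response f t k + f (t + k)%N else 0.

(** The quadratic form of the controllability Gramian of n steps from t. The recursion allows a
    block to be cut at an intermediate time. *)
Fixpoint gramian (t n : nat) (v : 'cV[R]_d) : R :=
  if n is k.+1 then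
    enorm ((B (t + k)%N)^T *m v) ^+ 2 + gramian t k ((A (t + k)%N)^T *m v)
  else 0.

Lemma trajectoryE (x f : nat -> 'cV[R]_d) t n :
  (forall i, (i < n)%N -> x (t + i).+1 = A (t + i)%N *m x (t + i)%N + f (t + i)%N) ->
  x (t + n)%N = transition A t n *m x t + response f t n.
Proof.
elim: n => [|n IH] h; first by rewrite addn0 mul1mx addr0.
rewrite addnS h // IH => [|i ni]; last by apply: h; exact: ltnW.
by rewrite /= mulmxDr -mulmxA addrA.
Qed.

Lemma eq_response (f g : nat -> 'cV[R]_d) t n :
  (forall i, (i < n)%N -> f (t + i)%N = g (t + i)%N) ->
  response f t n = response g t n.
Proof.
elim: n => //= n IH h; rewrite IH ?h // => i ni; apply: h; exact: ltnW.
Qed.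

Lemma responseD (f g : nat -> 'cV[R]_d) t n :
  response (fun s => f s + g s) t n = response f t n + response g t n.
Proof.
by elim: n => /= [|n ->]; rewrite ?addr0 // mulmxDr addrACA.
Qed.

Lemma transition_cat t j m :
  transition A t (j + m) = transition A (t + j) m *m transition A t j.
Proof.
elim: m => [|m IH]; first by rewrite addn0 mul1mx.
by rewrite addnS /= IH addnA mulmxA.
Qed.

Lemma response_cat f t j m :
  response f t (j + m) = transition A (t + j) m *m response f t j
    + response f (t + j) m.
Proof.
elim: m => [|m IH]; first by rewrite addn0 mul1mx addr0.
by rewrite addnS /= IH addnA mulmxDr mulmxA addrA.
Qed.

Lemma gramian_cat t j m v :
  gramian t (j + m) v = gramian (t + j) m v
    + gramian t j ((transition A (t + j) m)^T *m v).
Proof.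
elim: m v => [|m IH] v; first by rewrite addn0 add0r trmx1 mul1mx.
by rewrite addnS /= IH addnA addrA trmx_mul mulmxA.
Qed.

(** Inputs are stacked latest first, so splitting off block 0 matches the last step of
    [response]. *)
Lemma lifted_B_response H (u : nat -> 'cV[R]_p) t :
  lifted_B H A B t *m planned_inputs H u t = response (fun s => B s *m u s) t H.
Proof.
rewrite mul_mxrow_mxcol.
elim: H => [|H IH]; first by rewrite big_ord0.
rewrite big_ord_recl /= -IH mulmx_sumr addrC; congr (_ + _).
  apply: eq_bigr => j _; rewrite /bump /= add1n !mulmxA; congr (_ *m _ *m _ *m _).
  - by congr (A _); have := ltn_ord j; lia.
  - by congr (transition A _ _); have := ltn_ord j; lia.
  - by congr (B _); have := ltn_ord j; lia.
  - by congr (u _); have := ltn_ord j; lia.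
by rewrite mul1mx addnS subn1.
Qed.

Lemma enorm_mxcol H (F : 'I_H -> 'cV[R]_p) :
  enorm (\mxcol_j F j) ^+ 2 = \sum_j enorm (F j) ^+ 2.
Proof.
by rewrite enorm_stack; apply: eq_bigr => j _; rewrite mxcolK.
Qed.

Lemma gramian_lifted_B H t v :
  gramian t H v = enorm ((lifted_B H A B t)^T *m v) ^+ 2.
Proof.
rewrite /lifted_B tr_mxrow mxcol_mul enorm_mxcol.
elim: H v => [|H IH] v; first by rewrite big_ord0.
rewrite big_ord_recl /= IH; congr (_ + _).
  by rewrite trmx_mul trmx1 mulmx1 addnS subn1.
apply: eq_bigr => j _; rewrite /bump /= add1n; congr (enorm _ ^+ 2).
rewrite mulmxA -trmx_mul !mulmxA; congr ((_ *m _ *m _)^T *m _).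
- by congr (A _); have := ltn_ord j; lia.
- by congr (transition A _ _); have := ltn_ord j; lia.
- by congr (B _); have := ltn_ord j; lia.
Qed.

Variables (a b : R) (t : nat).
Hypotheses (a0 : 0 <= a) (b0 : 0 <= b) (t1 : (1 <= t)%N).
Hypothesis Aa : forall s, (1 <= s)%N -> opbound (A s) a.
Hypothesis Bb : forall s, (1 <= s)%N -> opbound (B s) b.

Lemma transition_bound n v : enorm (transition A t n *m v) <= a ^+ n * enorm v.
Proof.
elim: n => [|n IH]; first by rewrite mul1mx mul1r.
rewrite /= -mulmxA; apply: le_trans (Aa _ _) _; first by rewrite ltn_addr.
by rewrite exprS -mulrA ler_wpM2l.
Qed.

Lemma response_bound f F n :
  (forall i, (i < n)%N -> enorm (f (t + i)%N) <= F) ->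
  enorm (response f t n) <= geosum a n * F.
Proof.
elim: n => [|n IH] h; first by rewrite enorm0 geosum0 mul0r.
rewrite /=; apply: le_trans (enormD _ _) _; rewrite geosumS mulrDl mul1r.
apply: lerD; last exact: h.
apply: le_trans (Aa _ _) _; first by rewrite ltn_addr.
by rewrite -mulrA ler_wpM2l // IH // => i ni; apply: h; exact: ltnW.
Qed.

Lemma gramian_bound n v :
  gramian t n v <= b ^+ 2 * geosum (a ^+ 2) n * enorm v ^+ 2.
Proof.
elim: n v => [|n IH] v; first by rewrite geosum0 mulr0 mul0r.
have h1 : enorm ((B (t + n)%N)^T *m v) <= b * enorm v.
  by apply: opbound_tr => //; apply: Bb; rewrite ltn_addr.
have h2 : enorm ((A (t + n)%N)^T *m v) <= a * enorm v.
  by apply: opbound_tr => //; apply: Aa; rewrite ltn_addr.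
rewrite /= geosumS; apply: le_trans (lerD (lexx _) (IH _)) _.
have h1' : enorm ((B (t + n)%N)^T *m v) ^+ 2 <= b ^+ 2 * enorm v ^+ 2.
  by rewrite -exprMn ler_pXn2r // nnegrE ?mulr_ge0 ?enorm_ge0.
have h2' : enorm ((A (t + n)%N)^T *m v) ^+ 2 <= a ^+ 2 * enorm v ^+ 2.
  by rewrite -exprMn ler_pXn2r // nnegrE ?mulr_ge0 ?enorm_ge0.
have g0 : 0 <= b ^+ 2 * geosum (a ^+ 2) n.
  by rewrite mulr_ge0 ?geosum_ge0 ?sqr_ge0.
have -> : b ^+ 2 * (a ^+ 2 * geosum (a ^+ 2) n + 1) * enorm v ^+ 2
  = b ^+ 2 * enorm v ^+ 2 + b ^+ 2 * geosum (a ^+ 2) n * (a ^+ 2 * enorm v ^+ 2).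
  by ring.
exact: lerD h1' (ler_wpM2l g0 h2').
Qed.

Lemma geosum_sqr n : geosum (a ^+ 2) n <= geosum a n ^+ 2.
Proof.
elim: n => [|n IH]; first by rewrite !geosum0 expr0n.
rewrite !geosumS; have g0 := geosum_ge0 a0 n.
have -> : (a * geosum a n + 1) ^+ 2
  = a ^+ 2 * geosum a n ^+ 2 + 2 * (a * geosum a n) + 1 by ring.
have := ler_wpM2l (sqr_ge0 a) IH; have := mulr_ge0 a0 g0; lra.
Qed.

End Dynamics.

(** * Disturbance-free motion inside a block *)

Section BlockFlow.
Variables (R : realType) (d p H : nat).
Variables (A : nat -> 'M[R]_d) (B : nat -> 'M[R]_(d, p)).

(** Inverse of [planned_inputs] on t <= s < t + H. At other times truncated subtraction picks an end
    block of the stack, which obeys the same norm bound. *)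
Definition inputs (t : nat) (U : 'cV[R]_(stack H p)) (s : nat) : 'cV[R]_p :=
  if insub (H - (s - t).+1)%N is Some j then submxcol U j else 0.

Lemma inputs_planned u t s : (t <= s < t + H)%N ->
  inputs t (planned_inputs H u t) s = u s.
Proof.
move=> /andP[ts sH]; rewrite /inputs insubT; first by lia.
by move=> lt; rewrite mxcolK /=; congr u; lia.
Qed.

Lemma planned_inputsK t U : planned_inputs H (inputs t U) t = U.
Proof.
rewrite -[RHS]submxcolK; apply: eq_mxcol => j; rewrite /inputs.
have -> : (H - (t + H - j.+1 - t).+1)%N = j by have := ltn_ord j; lia.
by rewrite valK.
Qed.

Lemma enorm_inputs t U s : enorm (inputs t U s) <= enorm U.
Proof.
by rewrite /inputs; case: insub => [j|]; rewrite ?enorm_submxcol // enorm0 enorm_ge0.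
Qed.

Lemma inputsD t U V s : inputs t (U + V) s = inputs t U s + inputs t V s.
Proof.
by rewrite /inputs; case: insub => [j|]; rewrite ?addr0 //; apply/matrixP => i k;
  rewrite !mxE.
Qed.

(** All inputs of the block are fixed by its initial state z, so this is linear in z even at
    intermediate times. *)
Definition flow (K : 'M[R]_(stack H p, d)) (t n : nat) (z : 'cV[R]_d) : 'cV[R]_d :=
  transition A t n *m z + response A (fun s => B s *m inputs t (K *m z) s) t n.

Lemma flowD K t n y z : flow K t n (y + z) = flow K t n y + flow K t n z.
Proof.
rewrite /flow mulmxDr addrACA -responseD; congr (_ + _).
by apply: eq_response => i _; rewrite mulmxDr inputsD mulmxDr.
Qed.

Lemma flow_block K t z :
  flow K t H z = (lifted_A H A t + lifted_B H A B t *m K) *m z.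
Proof.
by rewrite /flow -lifted_B_response planned_inputsK mulmxDl mulmxA.
Qed.

Variables (a b S : R) (K : 'M[R]_(stack H p, d)) (t : nat).
Hypotheses (a0 : 0 <= a) (b0 : 0 <= b) (S0 : 0 <= S) (t1 : (1 <= t)%N).
Hypothesis Aa : forall s, (1 <= s)%N -> opbound (A s) a.
Hypothesis Bb : forall s, (1 <= s)%N -> opbound (B s) b.
Hypothesis KS : forall z, enorm (K *m z) <= S * a ^+ H * enorm z.

Lemma input_effect_le z s : (1 <= s)%N ->
  enorm (B s *m inputs t (K *m z) s) <= b * (S * a ^+ H * enorm z).
Proof.
move=> s1; apply: le_trans (Bb s1 _) _; rewrite ler_wpM2l //.
exact: le_trans (enorm_inputs _ _ _) (KS z).
Qed.

Lemma flow_le n z :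
  enorm (flow K t n z) <= (a ^+ n + a ^+ H * (b * S * geosum a n)) * enorm z.
Proof.
apply: le_trans (enormD _ _) _; rewrite mulrDl; apply: lerD.
  exact: transition_bound.
have -> : a ^+ H * (b * S * geosum a n) * enorm z
  = geosum a n * (b * (S * a ^+ H * enorm z)) by ring.
apply: response_bound => // i _; apply: input_effect_le.
by rewrite ltn_addr.
Qed.

(* Running the dynamics backwards from the end of the block: if the late inputs
   alone do not control the system, the transition [E] from time [t + n] to the
   end of the block cannot be too contracting. *)
Lemma flow_backward_le n z sigma : (n <= H)%N ->
  loewner_le sigma%:M (lifted_B H A B t *m (lifted_B H A B t)^T) ->
  b ^+ 2 * geosum a (H - n) ^+ 2 < sigma ->
  (sigma - b ^+ 2 * geosum a (H - n) ^+ 2) * enorm (flow K t n z) ^+ 2 <=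
  b ^+ 2 * geosum a n ^+ 2 * (enorm (flow K t H z)
    + geosum a (H - n) * (b * (S * a ^+ H * enorm z))) ^+ 2.
Proof.
move=> nH Bs sm; set x := flow K t n z.
set m := geosum a (H - n) in sm *; set F := b * _.
pose E := transition A (t + n) (H - n).
have tn1 : (1 <= t + n)%N by rewrite ltn_addr.
have Ex : enorm (E *m x) <= enorm (flow K t H z) + m * F.
  pose f s := B s *m inputs t (K *m z) s.
  have -> : E *m x = flow K t H z - response A f (t + n) (H - n).
    have e1 : transition A t H = E *m transition A t n.
      by rewrite -transition_cat subnKC.
    have e2 : response A f t H = E *m response A f t n
        + response A f (t + n) (H - n) by rewrite -response_cat subnKC.
    by rewrite /x /flow -/f e1 e2 addrA addrK -mulmxA -mulmxDr.
  apply: le_trans (enormB _ _) _; rewrite lerD2l.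
  apply: response_bound => // i _; apply: input_effect_le.
  by rewrite ltn_addr.
have g0 k : 0 <= geosum a k by exact: geosum_ge0.
(* The Gramian of the block splits at t + n; what the late inputs do not supply of sigma must come
   from the early ones, seen through E^T. *)
have gram v : (sigma - b ^+ 2 * m ^+ 2) * enorm v ^+ 2 <=
    b ^+ 2 * geosum a n ^+ 2 * enorm (E^T *m v) ^+ 2.
  have h1 : sigma * enorm v ^+ 2 <= gramian A B t H v.
    rewrite gramian_lifted_B; have := form_psd v Bs.
    rewrite formB form_scalar -enorm_sqr subr_ge0 => /le_trans; apply.
    by rewrite enorm_sqr -(form_congr _ 1%:M) mulmx1.
  rewrite -(subnKC nH) gramian_cat in h1.
  have h2 := gramian_bound a0 b0 tn1 Aa Bb (H - n) v.
  have h3 := gramian_bound a0 b0 t1 Aa Bb n (E^T *m v).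
  have h4 : b ^+ 2 * geosum (a ^+ 2) (H - n) * enorm v ^+ 2
      <= b ^+ 2 * m ^+ 2 * enorm v ^+ 2.
    by rewrite ler_wpM2r ?sqr_ge0 // ler_wpM2l ?sqr_ge0 // geosum_sqr.
  have h5 : b ^+ 2 * geosum (a ^+ 2) n * enorm (E^T *m v) ^+ 2
      <= b ^+ 2 * geosum a n ^+ 2 * enorm (E^T *m v) ^+ 2.
    by rewrite ler_wpM2r ?sqr_ge0 // ler_wpM2l ?sqr_ge0 // geosum_sqr.
  rewrite mulrBl; move: h1 h2 h3 h4 h5; rewrite -/E; lra.
have sp : 0 < sigma - b ^+ 2 * m ^+ 2 by rewrite subr_gt0.
have Eu : E \in unitmx.
  rewrite -row_free_unit -kermx_eq0; apply/eqP/row_matrixP => i.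
  rewrite row0; apply/eqP; rewrite -trmx_eq0 -enorm_eq0 -sqrf_eq0.
  rewrite eq_le sqr_ge0 andbT -(ler_pM2l sp) mulr0.
  apply: le_trans (gram _) _.
  by rewrite -trmx_mul -row_mul mulmx_ker row0 trmx0 enorm0 expr0n mulr0.
(* With x = E^T v, the square of |x| is the inner product of v and E x, while [gram] bounds |v| by
   |x|; eliminating |v| gives the claim. *)
pose v := invmx E^T *m x.
have Ev : E^T *m v = x by rewrite mulKVmx // unitmx_tr.
have := gram v; rewrite Ev => gv.
have xx : enorm x ^+ 2 <= enorm v * (enorm (flow K t H z) + m * F).
  rewrite enorm_sqr -{1}Ev -form1_mul; apply: le_trans (form1_le _ _) _.
  by rewrite ler_wpM2l ?enorm_ge0.
have [->|x0] := eqVneq (enorm x) 0.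
  by rewrite expr0n mulr0 -!exprMn sqr_ge0.
have xp : 0 < enorm x ^+ 2 by rewrite exprn_even_gt0.
have Y0 : 0 <= enorm (flow K t H z) + m * F by apply: le_trans Ex; exact: enorm_ge0.
have xx2 : enorm x ^+ 2 * enorm x ^+ 2 <=
    enorm v ^+ 2 * (enorm (flow K t H z) + m * F) ^+ 2.
  rewrite -expr2 -exprMn ler_pXn2r // nnegrE ?sqr_ge0 //.
  by rewrite mulr_ge0 ?enorm_ge0.
have l1 := ler_wpM2l (ltW sp) xx2.
have l2 := ler_wpM2r (sqr_ge0 (enorm (flow K t H z) + m * F)) gv.
move: xp l1 l2; move: (enorm x ^+ 2) (enorm v ^+ 2) (_ ^+ 2) => X V Y xp l1 l2.
rewrite -(ler_pM2r xp); move: l1 l2; nra.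
Qed.

End BlockFlow.

(** * Scalar inequalities *)

Section Scalar.
Variable R : realFieldType.

Lemma le_of_sqr (x y : R) : 0 <= y -> x ^+ 2 <= y ^+ 2 -> x <= y.
Proof.
move=> y0 xy; rewrite leNgt; apply/negP => yx.
by move: xy; rewrite leNgt => /negP; apply; rewrite ltr_pXn2r ?nnegrE //; lra.
Qed.

(** Square both sides and use 4 s^2 y <= (s^2 + y)^2. *)
Lemma amgm_bound (s c y T : R) : 0 <= s -> 0 <= y -> T ^+ 2 <= 4 * c ^+ 4 * y ->
  s * T <= c ^+ 2 * (s ^+ 2 + y).
Proof.
move=> s0 y0 T4; apply: le_of_sqr.
  by rewrite mulr_ge0 ?sqr_ge0 // addr_ge0 ?sqr_ge0.
have -> : (c ^+ 2 * (s ^+ 2 + y)) ^+ 2 = c ^+ 4 * (s ^+ 2 + y) ^+ 2 by ring.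
rewrite exprMn.
apply: le_trans (ler_wpM2l (sqr_ge0 s) T4) _.
rewrite (_ : s ^+ 2 * _ = c ^+ 4 * (4 * (s ^+ 2 * y))); last by ring.
rewrite ler_wpM2l //; first by rewrite (exprM c 2 2) sqr_ge0.
have := sqr_ge0 (s ^+ 2 - y); lra.
Qed.

(* In units where [c] is the gain of the whole block, the block splits into an
   early part (state growth [P], gain [nu]) and a late part (growth [P'], gain
   [mu]); [y = P P']. *)
Lemma early_growth_bound (s c y P P' nu mu T : R) :
  1 <= s -> 1 <= c -> 0 < P -> 1 <= P' -> 0 <= nu -> 0 <= mu -> 0 <= T ->
  y = P * P' -> c = nu + P * mu -> c = mu + P' * nu -> 1 <= c * (P * mu) ->
  (y < P ^+ 2 -> mu <= nu) ->
  T <= P + y * nu ->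
  (mu < 1 -> (1 - mu ^+ 2) * T ^+ 2 <= nu ^+ 2 * (1 + mu * y) ^+ 2) ->
  s * T <= c ^+ 2 * (s ^+ 2 + y).
Proof.
move=> s1 c1 P0 P'1 nu0 mu0 T0 yE cE cE' cP munu Tf Tb.
have y0 : 0 < y by rewrite yE; nra.
apply: amgm_bound; [lra|lra|].
have yn : y * nu <= P * c by rewrite yE cE'; nra.
have TP : T <= (1 + c) * P by lra.
(* At early times the forward estimate suffices, with 1 + c <= 2 c. *)
have [Pc|Pc] := lerP (P ^+ 2) (c ^+ 2 * y).
  have h : T <= 2 * c * P by nra.
  have h2 : T ^+ 2 <= (2 * c * P) ^+ 2 by rewrite ler_pXn2r ?nnegrE //; nra.
  apply: le_trans h2 _.
  have -> : (2 * c * P) ^+ 2 = 4 * c ^+ 2 * P ^+ 2 by ring.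
  have -> : 4 * c ^+ 4 * y = 4 * c ^+ 2 * (c ^+ 2 * y) by ring.
  by rewrite ler_wpM2l // mulr_ge0 ?sqr_ge0.
have c2 : 1 <= c ^+ 2 by rewrite expr2; nra.
have yP : y < P ^+ 2 by apply: le_lt_trans Pc; nra.
have {}munu := munu yP.
have P1 : 1 <= P by rewrite yE expr2 in yP; nra.
have cc : 1 + c * nu <= c ^+ 2.
  by rewrite expr2 {3}cE; nra.
have Py : P <= y by rewrite yE; nra.
(* The backward estimate will give (y - 1) T^2 <= (9/4) c^4 y, which yields the factor 4 exactly
   when y - 1 >= 9/16. For smaller y, P <= y and c >= 6/5 make the forward estimate sufficient. *)
have [ys|yb] := lerP y (25 / 16).
  have cmu : 1 <= c * nu * P.
    by apply: le_trans cP _; have := ler_wpM2l (mulr_ge0 (le_trans ler01 c1)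
      (ltW P0)) munu; lra.
  have cn : 16 / 25 <= c * nu.
    have cn0 : 0 <= c * nu by rewrite mulr_ge0 //; lra.
    nra.
  have c12 : 6 / 5 <= c.
    by rewrite leNgt; apply/negP => c6; have : c ^+ 2 < (6 / 5) ^+ 2;
     [rewrite ltr_pXn2r ?nnegrE //; lra | lra].
  have k : (1 + c) ^+ 2 * (25 / 16) <= 4 * c ^+ 4.
    have k1 : (1 + c) * (5 / 4) <= 2 * c ^+ 2 by nra.
    have -> : (1 + c) ^+ 2 * (25 / 16) = ((1 + c) * (5 / 4)) ^+ 2 by field.
    have -> : 4 * c ^+ 4 = (2 * c ^+ 2) ^+ 2 by ring.
    by rewrite ler_pXn2r ?nnegrE //; nra.
  have T2 : T <= (1 + c) * y by nra.
  have T3 : T ^+ 2 <= ((1 + c) * y) ^+ 2 by rewrite ler_pXn2r ?nnegrE //; nra.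
  apply: le_trans T3 _; rewrite exprMn expr2 mulrA ler_wpM2r ?(ltW y0) //.
  apply: le_trans k; rewrite ler_wpM2l ?sqr_ge0 //.
have Pmu : P * mu <= c by lra.
have mu2 : mu ^+ 2 * y < 1.
  have h : (P * mu) ^+ 2 <= c ^+ 2 by rewrite ler_pXn2r ?nnegrE //; nra.
  rewrite ltNge; apply/negP => h1.
  have m2p : 0 < mu ^+ 2 by have := sqr_ge0 mu; nra.
  have h2 : c ^+ 2 * y * mu ^+ 2 < P ^+ 2 * mu ^+ 2 by rewrite ltr_pM2r.
  have h3 : c ^+ 2 * 1 <= c ^+ 2 * (mu ^+ 2 * y) by rewrite ler_wpM2l ?sqr_ge0.
  rewrite exprMn in h; lra.
have mu1 : mu < 1 by rewrite expr2 in mu2; nra.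
have {}Tb := Tb mu1.
have nuc : nu <= c ^+ 2 / 2.
  have c3 : 2 * (c ^+ 2 - 1) <= c * c ^+ 2.
    (* For c > 0 the cubic c^3 - 2 c^2 is minimal at 4/3, with value -32/27. *)
    by have := mulr_ge0 (sqr_ge0 (c - 4 / 3)) (_ : 0 <= c + 2 / 3); nra.
  have cp : 0 < c by lra.
  by rewrite -(ler_pM2l cp); lra.
have num : nu * (1 + mu * y) <= nu + c ^+ 2.
  have : (y * nu) * mu <= (P * c) * mu by rewrite ler_wpM2r.
  rewrite expr2; nra.
have num0 : 0 <= nu * (1 + mu * y) by nra.
have Tb2 : (1 - mu ^+ 2) * T ^+ 2 <= 9 / 4 * c ^+ 4.
  apply: le_trans Tb _; rewrite -exprMn.
  have -> : 9 / 4 * c ^+ 4 = (3 / 2 * c ^+ 2) ^+ 2 by field.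
  by rewrite ler_pXn2r ?nnegrE //; nra.
have T20 := sqr_ge0 T.
have h : (y - 1) * T ^+ 2 <= y * (9 / 4 * c ^+ 4).
  apply: le_trans (ler_wpM2l (ltW y0) Tb2); nra.
have c40 : 0 <= c ^+ 4 by rewrite (exprM c 2 2) sqr_ge0.
nra.
Qed.

(** The bound on T equals (1 - n) + n y (1 + c), an interpolation between 1 and y (1 + c); the
    inequality is checked at both ends. *)
Lemma contracting_growth_bound (s c y P n T : R) :
  1 <= s -> 1 <= c -> 0 <= y <= 1 -> 0 <= n <= 1 -> P = 1 + (y - 1) * n ->
  T <= P + y * (c * n) -> s * T <= c ^+ 2 * (s ^+ 2 + y).
Proof.
move=> s1 c1 /andP[y0 y1] /andP[n0 n1] PE Tf.
have c2 : 1 <= c ^+ 2 by rewrite expr2; nra.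
have s2 : s <= s ^+ 2 by rewrite expr2; nra.
have h1 : s <= c ^+ 2 * (s ^+ 2 + y).
  by apply: le_trans (ler_wpM2r (_ : 0 <= s ^+ 2 + y) c2); lra.
have h2 : s * (y * (1 + c)) <= c ^+ 2 * (s ^+ 2 + y).
  apply: le_trans (_ : s * (2 * c * y) <= _).
    by rewrite ler_wpM2l //; [lra|nra].
  apply: amgm_bound => //; [lra|].
  have -> : (2 * c * y) ^+ 2 = 4 * c ^+ 2 * (y * y) by ring.
  have -> : 4 * c ^+ 4 * y = 4 * c ^+ 2 * (c ^+ 2 * y) by ring.
  have yc : y * y <= c ^+ 2 * y by nra.
  by rewrite ler_wpM2l // mulr_ge0 ?sqr_ge0.
have : s * T <= (1 - n) * s + n * (s * (y * (1 + c))).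
  rewrite PE in Tf; have := ler_wpM2l (le_trans ler01 s1) Tf; nra.
nra.
Qed.

(* Equality holds for c the golden ratio and n = 1/c. *)
Lemma golden_bound (c n : R) : 0 <= c -> c ^+ 2 * n <= c ^+ 2 - 1 -> 0 < c ^+ 2 ->
  n * (1 + 2 * c) <= c ^+ 2.
Proof.
move=> c0 cn cp; rewrite -(ler_pM2l cp) mulrA.
apply: le_trans (_ : (c ^+ 2 - 1) * (1 + 2 * c) <= _).
  by rewrite ler_wpM2r //; lra.
have := sqr_ge0 (c ^+ 2 - c - 1); nra.
Qed.

(** For e = 2 the left side equals 1 + P + y n (1 + 2 c), and [golden_bound] controls the last term
    by c^2 y. *)
Lemma disturbance_expanding (e c y P A n : R) :
  0 <= y -> 1 <= c -> 0 <= n <= 1 -> P = 1 + (y - 1) * n -> P <= A ->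
  c ^+ 2 * n <= c ^+ 2 - 1 -> 0 <= P -> e <= 2 ->
  (P + y * (c * n)) * e + n <= A + c ^+ 2 * (1 + y).
Proof.
move=> y0 c1 /andP[n0 n1] PE PA cn P0 e2.
have g : n * (1 + 2 * c) <= c ^+ 2 by apply: golden_bound => //; nra.
have T0 : 0 <= P + y * (c * n) by rewrite addr_ge0 // !mulr_ge0 //; lra.
apply: le_trans (_ : (P + y * (c * n)) * 2 + n <= _).
  by rewrite lerD2r ler_wpM2l.
have : y * (n * (1 + 2 * c)) <= y * c ^+ 2 by rewrite ler_wpM2l.
have : 1 <= c ^+ 2 by rewrite expr2; nra.
nra.
Qed.

(** At the start of a block a bound e <= 2 would be too weak for c near 1 and small A and y; the
    bound by 1 + 2 c y leaves exactly the square (c - 1)^2 y. *)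
Lemma disturbance_contracting_start (e c y A : R) : 0 <= y -> y <= A -> 1 <= c ->
  e <= 1 + 2 * (c * y) -> e <= A + c ^+ 2 * (1 + y).
Proof. move=> y0 yA c1; have := sqr_ge0 (c - 1); nra. Qed.

(** Since 2 c n <= c^2 + n, the claim reduces to 2 - n + 3 n y <= A + k. This is affine in n, so it
    is checked at n k = 1 and n k = k - A. The disjunction separates blocks of length 2 from longer
    ones. *)
Lemma disturbance_contracting (e a c y P A n k : R) :
  0 <= a <= 1 -> 0 <= A <= a -> y = a * A -> 1 <= c -> k <= c ^+ 2 ->
  1 + a <= k -> 1 + A <= k -> 1 <= n * k -> n * k <= k - A ->
  P = 1 + (y - 1) * n ->
  (1 + a = k /\ A = a \/ A <= a ^+ 2 /\ 1 + a + A <= k) ->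
  0 <= P -> e <= 2 ->
  (P + y * (c * n)) * e + n <= A + c ^+ 2 * (1 + y).
Proof.
move=> /andP[a0 a1] /andP[A0 Aa] yE c1 kc ka kA n1 n2 PE alt P0 e2.
have k1 : 1 <= k by lra.
have n0 : 0 <= n by nra.
have nle1 : n <= 1 by nra.
have y0 : 0 <= y by rewrite yE mulr_ge0.
have T0 : 0 <= P + y * (c * n) by rewrite addr_ge0 // !mulr_ge0 //; lra.
apply: le_trans (_ : (P + y * (c * n)) * 2 + n <= _).
  by rewrite lerD2r ler_wpM2l.
have h : 2 - n + 3 * (n * y) <= A + k.
  have kp : 0 < k by lra.
  rewrite -(ler_pM2r kp).
  have lo : 2 * k - 1 + 3 * y <= (A + k) * k by rewrite yE; nra.
  have hi : 2 * k - (k - A) + 3 * ((k - A) * y) <= (A + k) * k.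
    case: alt => [[<- ->]|[Aa2 kaA]]; first by rewrite yE; nra.
    have aA0 : 0 <= a * A by rewrite mulr_ge0.
    have f0 : 0 <= a + a ^+ 2 + A + 2 * A ^+ 2 - 3 * (a ^+ 2 * A).
      have : a ^+ 2 * A <= a by rewrite expr2; nra.
      have : a ^+ 2 * A <= A by rewrite expr2; nra.
      have : a ^+ 2 * A <= a ^+ 2 by rewrite ler_piMr ?sqr_ge0; lra.
      have := sqr_ge0 A; lra.
    have f1 : 0 <= (k - (1 + a + A)) * (k + a + 2 * A - 3 * y).
      by rewrite mulr_ge0 //; [lra|rewrite yE; nra].
    rewrite -subr_ge0.
    have -> : (A + k) * k - (2 * k - (k - A) + 3 * ((k - A) * y))
      = (k - (1 + a + A)) * (k + a + 2 * A - 3 * y)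
        + (a + a ^+ 2 + A + 2 * A ^+ 2 - 3 * (a ^+ 2 * A)) by rewrite yE; ring.
    exact: addr_ge0.
  have -> : (2 - n + 3 * (n * y)) * k = 2 * k - (n * k) + 3 * (n * k * y) by ring.
  move: (n * k) n1 n2 => N n1 n2.
  (* The sign of 3 y - 1 decides which end point is the worst case. *)
  have [y3|y3] := lerP (3 * y) 1; nra.
have : y * (c - n) ^+ 2 >= 0 by rewrite mulr_ge0 ?sqr_ge0.
nra.
Qed.

End Scalar.

(** * Closed loop *)

Ltac nat_lia :=
  repeat match goal with
  | h : ?T |- _ =>
    lazymatch T with
    | is_true (leq _ _) => fail
    | @eq nat _ _ => fail
    | _ => clear h
    end
  end; lia.

Section GeosumSquare.
Variables (R : realType) (a : R).
Hypothesis a0 : 0 < a.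

(** One factor a^i of each term is replaced by its largest possible value. For a <= 1 this later
    yields kappa_A <= c^2, which is stronger than c >= 1. *)
Lemma geosum_sqr_le n : geosum (a ^+ 2) n <= geosum a n * Num.max 1 (a ^+ n.-1).
Proof.
rewrite /geosum mulr_suml; apply: ler_sum => i _.
rewrite -exprM mulnC exprM expr2 ler_wpM2l ?exprn_ge0 ?(ltW a0) //.
rewrite le_max; have [a1|a1] := lerP a 1.
  by rewrite exprn_ile1 // ltW.
apply/orP; right; rewrite ler_weXn2l ?(ltW a1) //.
by have := ltn_ord i; nat_lia.
Qed.

End GeosumSquare.

(** The deadbeat gain, for which the closed-loop map of the block is 0, with state covariance [W]
    and no noise: nothing is propagated, so the constraints are immediate. *)
Lemma sdp_feasible_exists (R : realType) (d p H : nat) (alpha sigma : R)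
    (W : 'M[R]_d) (A : nat -> 'M[R]_d) (B : nat -> 'M[R]_(d, p)) (t : nat) :
  posdef W -> 0 <= alpha -> 0 < sigma ->
  loewner_le sigma%:M (lifted_B H A B t *m (lifted_B H A B t)^T) ->
  exists S : 'M[R]_(d + stack H p), sdp_feasible alpha W A B t S.
Proof.
move=> Wp a0 s0 Bs; set Bt := lifted_B H A B t in Bs.
have Bu : Bt *m Bt^T \in unitmx.
  apply: posdef_unit; split=> [|v v0]; first by rewrite trmx_mul trmxK.
  rewrite -/(form _ v v); have := form_psd v Bs.
  rewrite formB form_scalar -enorm_sqr subr_ge0; apply: lt_le_trans.
  by rewrite mulr_gt0 // exprn_gt0 ?enorm_gt0.
pose K := - (Bt^T *m invmx (Bt *m Bt^T) *m lifted_A H A t).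
have MK : lifted_A H A t + Bt *m K = 0.
  by rewrite mulmxN !mulmxA mulmxV // mul1mx subrr.
have P0 : propagated A B t (joint W K 0) = 0.
  by rewrite /propagated propagated_joint MK !mul0mx mulmx0 mul0mx addr0.
exists (joint W K 0); rewrite /sdp_feasible P0 add0r block_mxKul; split=> //.
  apply: psd_joint; first exact: posdef_psd.
  by split; [rewrite trmx0 | move=> v; rewrite mulmx0 mul0mx mxE].
rewrite /loewner_le subr0; split; first by rewrite linearZ /= Wp.1.
by move=> v; rewrite -/(form _ v v) formZ mulr_ge0 //; exact/form_psd/posdef_psd.
Qed.

Section ClosedLoop.
Variables (R : realType) (d p H : nat).
Variables (Q : 'M[R]_d) (Rc : 'M[R]_p) (W : 'M[R]_d) (alpha a b sigma : R).
Variables (A : nat -> 'M[R]_d) (B : nat -> 'M[R]_(d, p)).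
Hypotheses (Qp : posdef Q) (Rp : posdef Rc) (Wp : posdef W).
Hypotheses (H1 : (1 <= H)%N) (a01 : 0 <= alpha < 1).
Hypotheses (s0 : 0 < sigma) (a0 : 0 < a) (b0 : 0 < b).
Hypothesis ctrl : forall t : nat, (1 <= t)%N ->
  loewner_le sigma%:M (lifted_B H A B t *m (lifted_B H A B t)^T).
Hypothesis Aa : forall s, (1 <= s)%N -> opbound (A s) a.
Hypothesis Bb : forall s, (1 <= s)%N -> opbound (B s) b.
Hypothesis d0 : (0 < d)%N.

Let a0' : 0 <= a := ltW a0.
Let b0' : 0 <= b := ltW b0.
Let y := a ^+ H.
Let kA := geosum a H.
Let S := Num.sqrt (cond_number Rc / sigma).
Let beta := b * S.
(* Then kappa_A' = a ^ (H - 1) + c ^ 2 * (kappa + y). *)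
Let c := beta * kA.
Let rho := Num.sqrt (alpha / (1 - alpha)).
Let s := Num.sqrt (cond_number W).

Let S0 : 0 <= S. Proof. exact: sqrtr_ge0. Qed.
Let S2 : S ^+ 2 = cond_number Rc / sigma.
Proof. by rewrite sqr_sqrtr // divr_ge0 ?cond_number_ge0 // ltW. Qed.
Let beta0 : 0 <= beta. Proof. exact: mulr_ge0. Qed.
Let y0 : 0 < y. Proof. exact: exprn_gt0. Qed.
Let kA1 : 1 <= kA. Proof. exact: geosum_ge1. Qed.

Lemma beta_sqr : beta ^+ 2 * sigma = b ^+ 2 * cond_number Rc.
Proof.
by rewrite /beta exprMn S2 -mulrA divfK // gt_eqF.
Qed.

Lemma c_sqr : c ^+ 2 = b ^+ 2 * kA ^+ 2 * cond_number Rc / sigma.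
Proof.
apply: (mulIf (lt0r_neq0 s0)); rewrite divfK ?lt0r_neq0 //.
by rewrite /c exprMn mulrAC beta_sqr; ring.
Qed.

Lemma gramian_sum_ge : sigma <= b ^+ 2 * geosum (a ^+ 2) H.
Proof.
pose v : 'cV[R]_d := const_mx 1.
have vp : 0 < enorm v ^+ 2.
  rewrite exprn_gt0 // enorm_gt0; apply/eqP => /matrixP /(_ (Ordinal d0) 0).
  by rewrite !mxE => /eqP; rewrite oner_eq0.
rewrite -(ler_pM2r vp).
apply: le_trans (gramian_bound a0' b0' (leqnn 1) Aa Bb H v).
rewrite gramian_lifted_B; have := form_psd v (ctrl (leqnn 1)).
rewrite formB form_scalar -enorm_sqr subr_ge0 => /le_trans; apply.
by rewrite enorm_sqr -(form_congr _ 1%:M) mulmx1.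
Qed.

(** Without inputs the Gramian vanishes, against sigma > 0. This makes the condition number of [Rc]
    at least 1. *)
Lemma p_gt0 : (0 < p)%N.
Proof.
case: (posnP p) => // p0; exfalso; move: ctrl; subst p => ctrl'.
pose v : 'cV[R]_d := const_mx 1.
have vp : 0 < enorm v ^+ 2.
  rewrite exprn_gt0 // enorm_gt0; apply/eqP => /matrixP /(_ (Ordinal d0) 0).
  by rewrite !mxE => /eqP; rewrite oner_eq0.
have := form_psd v (ctrl' 1%N (leqnn 1)); rewrite formB form_scalar -enorm_sqr.
rewrite -[X in X *m _]mulmx1 (form_congr _ 1%:M) -enorm_sqr -gramian_lifted_B.
suff -> : gramian A B 1 H v = 0 by rewrite sub0r oppr_ge0 leNgt mulr_gt0.
elim: H v {vp} => //= k IH v; rewrite IH addr0.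
by rewrite [_^T *m _]flatmx0 enorm0 expr0n.
Qed.

Lemma beta_geosum_ge1 : 1 <= beta ^+ 2 * geosum (a ^+ 2) H.
Proof.
have := cond_number_ge1 p_gt0 (posdef_unit Rp) => k1.
rewrite -(ler_pM2r s0) mul1r mulrAC beta_sqr mulrAC.
apply: le_trans gramian_sum_ge _; apply: ler_peMr => //.
by rewrite mulr_ge0 ?sqr_ge0 // geosum_ge0 ?sqr_ge0.
Qed.

Lemma c_ge1 : 1 <= c.
Proof.
rewrite -(ler_pXn2r (n:=2)) ?nnegrE ?mulr_ge0 ?geosum_ge0 // expr1n.
apply: le_trans beta_geosum_ge1 _.
rewrite /c [X in _ <= X]exprMn ler_wpM2l ?sqr_ge0 //.
exact: geosum_sqr.
Qed.

Lemma beta_kA_ge : 1 <= beta ^+ 2 * (kA * Num.max 1 (a ^+ H.-1)).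
Proof.
apply: le_trans beta_geosum_ge1 _; rewrite ler_wpM2l ?sqr_ge0 //.
exact: geosum_sqr_le.
Qed.

Lemma enorm_lifted_B t U : (1 <= t)%N ->
  enorm (lifted_B H A B t *m U) <= kA * (b * enorm U).
Proof.
move=> t1; rewrite -{1}(planned_inputsK t U) lifted_B_response.
apply: response_bound => // i _; apply: le_trans (Bb _ _) _.
  by rewrite ltn_addr.
by rewrite ler_wpM2l // enorm_inputs.
Qed.

(** * Growth within a block under an optimal gain *)

Section Gain.
Variables (t : nat) (Sig : 'M[R]_(d + stack H p)).
Hypotheses (t1 : (1 <= t)%N) (Sopt : sdp_optimal alpha Q Rc W A B t Sig).
Let K := sdp_gain Sig.

Lemma gain_cost_le (U h : 'cV[R]_(stack H p)) z :
  form (lifted_R H Rc) U U <= form (lifted_R H Rc) h h ->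
  sigma * enorm h ^+ 2 <= enorm (lifted_A H A t *m z) ^+ 2 ->
  enorm U <= S * y * enorm z.
Proof.
move=> Uh hz; apply: enorm_le; first by rewrite mulr_ge0 // ltW.
rewrite [X in X * _]exprMn S2.
have h1 := enorm_le_stack U Rp; have h2 := form_stack_le Rc h.
have i0 : 0 <= spnorm (invmx Rc) by exact: spnorm_ge0.
have h3 := le_trans h1 (ler_wpM2l i0 (le_trans Uh h2)).
have h4 : enorm (lifted_A H A t *m z) ^+ 2 <= (y * enorm z) ^+ 2.
  rewrite ler_pXn2r ?nnegrE ?mulr_ge0 ?enorm_ge0 ?(ltW y0) //.
  exact: transition_bound.
rewrite -(ler_pM2l s0).
have -> : sigma * (cond_number Rc / sigma * y ^+ 2 * enorm z ^+ 2)
   = cond_number Rc * (y * enorm z) ^+ 2 by field; rewrite gt_eqF.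
apply: le_trans (ler_wpM2l (cond_number_ge0 Rc) (le_trans hz h4)).
apply: le_trans (ler_wpM2l (ltW s0) h3) _.
by rewrite le_eqVlt; apply/orP; left; apply/eqP; rewrite /cond_number; ring.
Qed.

Lemma gain_le z : enorm (K *m z) <= S * y * enorm z.
Proof.
have [h hE hs] := loewner_right_inverse (lifted_A H A t *m z) s0 (ctrl t1).
have [h1 _] := optimal_input_le Qp Rp Wp a01 Sopt hE.
exact: gain_cost_le h1 hs.
Qed.

(** Writing A~ z = B~ h turns the closed-loop map into B~ (K z + h), and optimality bounds the cost
    of K z + h by that of h. *)
Lemma block_map_le z : enorm (flow A B K t H z) <= c * y * enorm z.
Proof.
have [h hE hs] := loewner_right_inverse (lifted_A H A t *m z) s0 (ctrl t1).
have [_ h2] := optimal_input_le Qp Rp Wp a01 Sopt hE.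
rewrite flow_block mulmxDl -hE -mulmxA -mulmxDr addrC.
apply: le_trans (enorm_lifted_B _ t1) _.
have := gain_cost_le h2 hs.
have kb : 0 <= kA * b by rewrite mulr_ge0 // geosum_ge0.
move=> /(ler_wpM2l kb); rewrite /c /beta addrC; lra.
Qed.

Lemma block_map_contr z :
  form (invmx W) (flow A B K t H z) (flow A B K t H z)
    <= rho ^+ 2 * form (invmx W) z z.
Proof.
have [h _] := optimal_block_facts Qp Rp Wp a01 Sopt.
rewrite flow_block sqr_sqrtr; first exact: h.
by case/andP: a01 => ? ?; rewrite divr_ge0 // subr_ge0 ltW.
Qed.

Variable j : nat.
Hypothesis jH : (j < H)%N.

Let n := geosum a j / kA.
Let nkA : n * kA = geosum a j.
Proof. by rewrite divfK // gt_eqF // (lt_le_trans ltr01). Qed.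

Lemma growth_eq : a ^+ j = 1 + (y - 1) * n.
Proof.
rewrite geosumE /y geosumE -nkA -/kA; ring.
Qed.

Lemma gain_fraction_bounds : 0 <= n <= 1.
Proof.
have kp : 0 < kA by exact: lt_le_trans kA1.
apply/andP; split; rewrite -(ler_pM2r kp) nkA ?mul0r ?mul1r.
  exact: geosum_ge0.
by apply: geosum_le => //; exact: ltnW.
Qed.

Lemma late_gain_ge : a ^+ H.-1 <= kA - geosum a j.
Proof.
have -> : kA = geosum a j + a ^+ j * geosum a (H - j).
  by rewrite -geosumD addnC subnKC // ltnW.
rewrite addrC addKr; have -> : H.-1 = (j + (H - j).-1)%N by nat_lia.
rewrite exprD ler_wpM2l ?exprn_ge0 //.
have -> : (H - j = (H - j).-1.+1)%N by nat_lia.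
by rewrite geosumSr /= lerDr geosum_ge0.
Qed.

Lemma late_gain_ge1 : 1 <= a -> 1 <= c * (beta * a ^+ H.-1).
Proof.
move=> a1; have := beta_kA_ge; rewrite max_r ?exprn_ege1 //.
by rewrite /c; lra.
Qed.

Lemma flow_mid_le z :
  enorm (flow A B K t j z) <= (a ^+ j + y * (beta * geosum a j)) * enorm z.
Proof. apply: flow_le => //; exact: gain_le. Qed.

(** [N] dominates the state at both ends of the block, because the forward estimate starts from one
    end and the backward estimate from the other. *)
Lemma flow_transient_le z N : 1 <= s -> enorm z <= N ->
  enorm (flow A B K t H z) <= N ->
  s * enorm (flow A B K t j z) <= c ^+ 2 * (s ^+ 2 + y) * N.
Proof.
move=> s1 zN MzN; have N0 : 0 <= N by exact: le_trans (enorm_ge0 z) zN.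
have g0 k : 0 <= geosum a k by exact: geosum_ge0.
have fw := le_trans (flow_mid_le z) (ler_wpM2l _ zN).
have {}fw : enorm (flow A B K t j z) <= (a ^+ j + y * (beta * geosum a j)) * N.
  by apply: fw; rewrite addr_ge0 ?exprn_ge0 // mulr_ge0 ?mulr_ge0 // ltW.
set X := enorm (flow A B K t j z) in fw *.
have X0 : 0 <= X by exact: enorm_ge0.
have [Nz|Nn] := eqVneq N 0.
  by rewrite Nz !mulr0 in fw *; nra.
have Np : 0 < N by rewrite lt_neqAle eq_sym Nn.
rewrite -ler_pdivrMr // -mulrA.
have fw' : X / N <= a ^+ j + y * (beta * geosum a j) by rewrite ler_pdivrMr.
have [a1|/ltW a1] := lerP a 1.
  apply: (contracting_growth_bound (n := n)) growth_eq _ => //.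
  - exact: c_ge1.
  - by rewrite ltW // exprn_ile1.
  - exact: gain_fraction_bounds.
  - by rewrite /c -mulrA [kA * n]mulrC nkA.
have jle : (j <= H)%N by exact: ltnW.
have cE : c = beta * geosum a j + a ^+ j * (beta * geosum a (H - j)).
  by rewrite /c /kA -{1}(subnK jle) geosumD; ring.
have cE' : c = beta * geosum a (H - j) + a ^+ (H - j) * (beta * geosum a j).
  by rewrite /c /kA -{1}(subnKC jle) geosumD; ring.
apply: (early_growth_bound (P := a ^+ j) (P' := a ^+ (H - j))
  (nu := beta * geosum a j) (mu := beta * geosum a (H - j))) => //.
- exact: c_ge1.
- exact: exprn_gt0.
- exact: exprn_ege1.
- exact: mulr_ge0.
- exact: mulr_ge0.
- exact: divr_ge0.
- by rewrite -exprD subnKC.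
- apply: le_trans (late_gain_ge1 a1) _.
  rewrite ler_wpM2l //; first by rewrite (le_trans ler01) // c_ge1.
  have : beta * a ^+ H.-1 <= c - beta * geosum a j.
    by rewrite /c -mulrBr ler_wpM2l // late_gain_ge.
  by rewrite {1}cE; lra.
- move=> yP; rewrite ler_wpM2l // geosum_le // leqNgt; apply/negP => jHj.
  move: yP; rewrite ltNge => /negP; apply.
  by rewrite -exprM ler_weXn2l //; nat_lia.
move=> mu1; set m := geosum a (H - j) in mu1 *.
(* As kappa_R >= 1, the gain b / sqrt sigma of the backward estimate is at most beta, the unit of
   the scalar inequality. *)
have bs : b ^+ 2 <= beta ^+ 2 * sigma.
  rewrite beta_sqr; apply: ler_peMr; first exact: sqr_ge0.
  exact: cond_number_ge1 p_gt0 (posdef_unit Rp).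
have m0 : 0 <= m by exact: g0.
have mu2 : (beta * m) ^+ 2 < 1.
  by rewrite expr_lt1 // mulr_ge0.
have bm : b ^+ 2 * m ^+ 2 <= (beta * m) ^+ 2 * sigma.
  have -> : (beta * m) ^+ 2 * sigma = beta ^+ 2 * sigma * m ^+ 2 by ring.
  by apply: ler_wpM2r => //; exact: sqr_ge0.
have sm : b ^+ 2 * m ^+ 2 < sigma.
  by apply: le_lt_trans bm _; rewrite gtr_pMl.
have := flow_backward_le a0' b0' t1 Aa Bb gain_le z jle (ctrl t1) sm.
rewrite -/X -/m => bw.
have late : enorm (flow A B K t H z) + m * (b * (S * a ^+ H * enorm z))
    <= N * (1 + beta * m * y).
  have e1 : N * (1 + beta * m * y) = N + m * (b * (S * y * N)).
    by rewrite /beta; ring.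
  rewrite e1 lerD // !ler_wpM2l //.
  by rewrite mulr_ge0 // ltW.
have late0 : 0 <= enorm (flow A B K t H z) + m * (b * (S * a ^+ H * enorm z)).
  by rewrite addr_ge0 ?enorm_ge0 ?mulr_ge0 ?enorm_ge0 // ltW.
have late2 := ler_pXn2r (n := 2) isT late0 (le_trans late0 late).
have {}late : (enorm (flow A B K t H z) + m * (b * (S * a ^+ H * enorm z))) ^+ 2
    <= (N * (1 + beta * m * y)) ^+ 2 by rewrite late2.
have bn : b ^+ 2 * geosum a j ^+ 2 <= beta ^+ 2 * sigma * geosum a j ^+ 2.
  by rewrite ler_wpM2r // sqr_ge0.
have h1 : (sigma * (1 - (beta * m) ^+ 2)) * X ^+ 2 <=
    (sigma - b ^+ 2 * m ^+ 2) * X ^+ 2.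
  by rewrite ler_wpM2r ?sqr_ge0 //; lra.
have h2 := le_trans (le_trans h1 bw) (ler_pM _ (sqr_ge0 _) bn late).
have {}h2 := h2 (mulr_ge0 (sqr_ge0 _) (sqr_ge0 _)).
rewrite expr_div_n -(ler_pM2l s0) -(ler_pM2r (exprn_gt0 2 Np)).
have -> : sigma * ((1 - (beta * m) ^+ 2) * (X ^+ 2 / N ^+ 2)) * N ^+ 2
  = sigma * (1 - (beta * m) ^+ 2) * X ^+ 2 by field.
by apply: le_trans h2 _; rewrite le_eqVlt; apply/orP; left; apply/eqP; ring.
Qed.

Lemma disturbance_bound e : 0 <= e -> e <= 2 -> e <= 1 + 2 * (c * y) ->
  (a ^+ j + y * (c * n)) * e + n <= a ^+ H.-1 + c ^+ 2 * (1 + y).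
Proof.
move=> e0 e2 ey; have c1 := c_ge1; have := gain_fraction_bounds => /andP[n0 n1].
have aj0 : 0 <= a ^+ j by exact: exprn_ge0.
have kp : 0 < kA by exact: lt_le_trans kA1.
have yA : y = a * a ^+ H.-1 by rewrite -exprS prednK.
have late : geosum a j <= kA - a ^+ H.-1 by have := late_gain_ge; lra.
have [a1|/ltW a1] := lerP a 1; last first.
  apply: disturbance_expanding => //; [exact: ltW|by rewrite n0|exact: growth_eq| |].
    by rewrite ler_weXn2l //; nat_lia.
  have h : beta * a ^+ H.-1 <= c - c * n.
    have -> : c - c * n = beta * (kA - geosum a j) by rewrite -nkA /c; ring.
    by rewrite ler_wpM2l // late_gain_ge.
  have := le_trans (late_gain_ge1 a1) (ler_wpM2l (le_trans ler01 c1) h).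
  by rewrite expr2; lra.
have Age0 : 0 <= a ^+ H.-1 by exact: exprn_ge0.
case: (posnP j) => [j0|jp].
  have -> : n = 0 by rewrite /n j0 geosum0 mul0r.
  rewrite j0 expr0 !mulr0 !addr0 mul1r.
  apply: disturbance_contracting_start => //; first exact: ltW.
  by rewrite yA ler_piMl.
have H2 : (2 <= H)%N by nat_lia.
have g2 : geosum a 2 = 1 + a by rewrite !geosumS geosum0; ring.
have kpred : kA = geosum a H.-1 + a ^+ H.-1 by rewrite -geosumSr prednK.
apply: (disturbance_contracting (a := a) (k := kA)) => //.
- by rewrite a0' a1.
- by rewrite Age0 -[X in _ <= X]expr1 ler_wiXn2l //; nat_lia.
- have := beta_kA_ge; rewrite max_l ?exprn_ile1 // mulr1 => h.
  have := ler_wpM2r (ltW kp) h; rewrite mul1r /c [X in _ -> _ <= X]exprMn.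
  by rewrite -mulrA -expr2.
- by rewrite -g2 geosum_le.
- by rewrite kpred lerD2r geosum_ge1 //; nat_lia.
- by rewrite nkA geosum_ge1.
- by rewrite nkA.
- exact: growth_eq.
case: (ltnP 2 H) => H3; last first.
  by have HE : H = 2%N by [nat_lia]; left; rewrite /kA HE g2 expr1.
right; split; first by rewrite ler_wiXn2l //; nat_lia.
by rewrite kpred lerD2r -g2 geosum_le //; nat_lia.
Qed.

(** Dividing by [F] reduces this to [disturbance_bound] for e = E / F; the fresh disturbance, of
    relative size n, is only enlarged since F >= 1. *)
Lemma flow_disturbance_le z E F wb : 0 <= wb -> 1 <= F -> 0 <= E ->
  E <= 2 * F -> E <= (1 + 2 * (c * y)) * F -> enorm z <= E * (kA * wb) ->
  enorm (flow A B K t j z) + geosum a j * wb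
    <= F * (a ^+ H.-1 + c ^+ 2 * (1 + y)) * (kA * wb).
Proof.
move=> wb0 F1 E0 E2 Ey zE; have c1 := c_ge1.
have := gain_fraction_bounds => /andP[n0 n1].
have Fp : 0 < F by lra.
have kw : 0 <= kA * wb by rewrite mulr_ge0 // geosum_ge0.
have sc := @disturbance_bound (E / F) (divr_ge0 E0 (ltW Fp)).
rewrite !ler_pdivrMr // in sc; have {}sc := sc E2 Ey.
have cn : beta * geosum a j = c * n by rewrite -nkA /c; ring.
have T0 : 0 <= a ^+ j + y * (c * n).
  rewrite addr_ge0 ?exprn_ge0 // mulr_ge0 ?(ltW y0) // mulr_ge0 //; lra.
apply: le_trans (_ : ((a ^+ j + y * (c * n)) * E + n) * (kA * wb) <= _).
  rewrite mulrDl [n * _]mulrA nkA; apply: lerD => //.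
  apply: le_trans (flow_mid_le z) _; rewrite cn -mulrA.
  exact: ler_wpM2l.
rewrite ler_wpM2r //.
have := ler_wpM2l (ltW Fp) sc.
have -> : F * ((a ^+ j + y * (c * n)) * (E / F) + n)
  = (a ^+ j + y * (c * n)) * E + F * n by field; rewrite gt_eqF.
apply: le_trans; rewrite lerD2l; nra.
Qed.

End Gain.

Let wnorm (z : 'cV[R]_d) : R := Num.sqrt (form (invmx W) z z).

Let rho0 : 0 <= rho. Proof. exact: sqrtr_ge0. Qed.

Lemma s_ge1 : 1 <= s.
Proof.
have k1 := cond_number_ge1 d0 (posdef_unit Wp).
by rewrite /s -[X in X <= _]sqrtr1 ler_sqrt // (le_trans ler01).
Qed.

Lemma enorm_le_wnorm z : enorm z <= Num.sqrt (spnorm W) * wnorm z.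
Proof.
rewrite -sqrtrM ?spnorm_ge0 // -(ger0_norm (enorm_ge0 z)) -sqrtr_sqr.
rewrite ler_sqrt; first exact: enorm_le_form_inv.
by rewrite mulr_ge0 ?spnorm_ge0 // form_psd //; exact: posdef_inv.
Qed.

Lemma wnorm_le_enorm z : wnorm z <= Num.sqrt (spnorm (invmx W)) * enorm z.
Proof.
rewrite -[X in _ * X](ger0_norm (enorm_ge0 z)) -sqrtr_sqr -sqrtrM ?spnorm_ge0 //.
rewrite ler_sqrt; first exact: form_le_spnorm.
by rewrite mulr_ge0 ?spnorm_ge0 ?sqr_ge0.
Qed.

Lemma wnorm_flow_le t (Sig : 'M[R]_(d + stack H p)) z :
  sdp_optimal alpha Q Rc W A B t Sig ->
  wnorm (flow A B (sdp_gain Sig) t H z) <= rho * wnorm z.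
Proof.
move=> Sopt; rewrite -[X in X * _](ger0_norm rho0) -sqrtr_sqr -sqrtrM ?sqr_ge0 //.
rewrite ler_sqrt; first exact: block_map_contr.
by rewrite mulr_ge0 ?sqr_ge0 // form_psd //; exact: posdef_inv.
Qed.

(** * Accumulation of disturbances from block to block *)

Section Trajectory.
Variables (x : nat -> 'cV[R]_d) (u : nat -> 'cV[R]_p) (w : nat -> 'cV[R]_d).
Hypothesis loop : closed_loop H alpha Q Rc W A B x u w.
Hypothesis rho1 : rho < 1.
Variables (t : nat) (wb : R).
Hypotheses (wb0 : 0 <= wb).
Hypothesis w_le : forall i, (1 <= i < t)%N -> enorm (w i) <= wb.

Let kw : 0 <= kA * wb. Proof. by rewrite mulr_ge0 // geosum_ge0. Qed.
Let sE : s = Num.sqrt (spnorm W) * Num.sqrt (spnorm (invmx W)).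
Proof. by rewrite -sqrtrM ?spnorm_ge0. Qed.

Lemma trajectory_flow tau (Sig : 'M[R]_(d + stack H p)) j :
  (1 <= tau)%N -> (j <= H)%N ->
  planned_inputs H u tau = sdp_gain Sig *m x tau ->
  x (tau + j)%N = flow A B (sdp_gain Sig) tau j (x tau) + response A w tau j.
Proof.
move=> tau1 jH uE.
rewrite (@trajectoryE _ _ A x (fun i => B i *m u i + w i)) => [|i ij].
  rewrite responseD addrA; congr (_ + _ + _); apply: eq_response => i ij.
  by rewrite -uE inputs_planned //; nat_lia.
by rewrite (proj1 loop) ?addrA //; nat_lia.
Qed.

Lemma disturbance_le tau j : (1 <= tau)%N -> (tau + j <= t)%N ->
  enorm (response A w tau j) <= geosum a j * wb.
Proof.
by move=> tau1 taut; apply: response_bound => // i ij; apply: w_le; nat_lia.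
Qed.

(** h carries the initial state and e the disturbances. The gains differ between blocks but all
    contract [wnorm]. The Euclidean bounds on e count the last block directly, without the factor s,
    and bound the older part either through [wnorm] or by c y. *)
Lemma block_decomposition k : (k * H < t)%N -> exists h e : 'cV[R]_d,
  [/\ x (k * H).+1 = h + e,
      wnorm h <= rho ^+ k * wnorm (x 1%N),
      wnorm e <= Num.sqrt (spnorm (invmx W)) * (kA * wb) / (1 - rho),
      enorm e <= (1 + s * (rho / (1 - rho))) * (kA * wb)
    & enorm e <= (1 + c * y * (1 + s * (rho / (1 - rho)))) * (kA * wb)].
Proof.
have r1 : 0 < 1 - rho by rewrite subr_gt0.
have r0 : 0 <= rho / (1 - rho) by rewrite divr_ge0 // ltW.
have sr0 : 0 <= s * (rho / (1 - rho)) by rewrite mulr_ge0 // sqrtr_ge0.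
have cy0 : 0 <= c * y.
  by rewrite mulr_ge0 ?(ltW y0) // (le_trans ler01) // c_ge1.
elim: k => [|k IH] kt.
  exists (x 1%N), 0; split.
  - by rewrite addr0.
  - by rewrite mul1r.
  - rewrite /wnorm /form mulmx0 mxE sqrtr0 divr_ge0 ?(ltW r1) //.
    by rewrite mulr_ge0 ?sqrtr_ge0.
  - by rewrite enorm0 mulr_ge0 // addr_ge0.
  - by rewrite enorm0 mulr_ge0 // addr_ge0 // mulr_ge0 // addr_ge0.
have {}IH := IH (ltac:(nat_lia) : (k * H < t)%N).
have [h [e [xE hk ek en en2]]] := IH.
pose tau := (k * H).+1.
have tau_mod : tau = 1 %[mod H] by rewrite /tau -addn1 modnMDl.
have [Sig Sopt uE] := proj2 loop tau isT tau_mod.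
pose K := sdp_gain Sig; pose f z := flow A B K tau H z.
have tauH : (tau + H = (k.+1 * H).+1)%N by rewrite /tau mulSn; nat_lia.
have v_le : enorm (response A w tau H) <= kA * wb.
  by apply: disturbance_le => //; rewrite tauH.
have fw z : wnorm (f z) <= rho * wnorm z by exact: wnorm_flow_le Sopt.
have fe1 : enorm (f e) <= s * (rho / (1 - rho)) * (kA * wb).
  apply: le_trans (enorm_le_wnorm _) _.
  apply: le_trans (ler_wpM2l (sqrtr_ge0 _) (fw e)) _.
  apply: le_trans (ler_wpM2l (sqrtr_ge0 _) (ler_wpM2l rho0 ek)) _.
  by rewrite le_eqVlt; apply/orP; left; apply/eqP; rewrite sE; field; rewrite gt_eqF.
have fe2 : enorm (f e) <= c * y * (1 + s * (rho / (1 - rho))) * (kA * wb).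
  apply: le_trans (block_map_le (isT : (1 <= tau)%N) Sopt e) _.
  by rewrite -[X in _ <= X]mulrA ler_wpM2l.
exists (f h), (f e + response A w tau H); split.
- rewrite -tauH (trajectory_flow (isT : (1 <= tau)%N) (leqnn H) uE) xE flowD.
  exact: esym (addrA _ _ _).
- apply: le_trans (fw h) _; rewrite exprS -mulrA; exact: ler_wpM2l.
- apply: le_trans (formD_sqrt _ _ (posdef_inv Wp)) _.
  have h1 := le_trans (fw e) (ler_wpM2l rho0 ek).
  have h2 := le_trans (wnorm_le_enorm (response A w tau H))
    (ler_wpM2l (sqrtr_ge0 (spnorm (invmx W))) v_le).
  apply: le_trans (lerD h1 h2) _; rewrite le_eqVlt; apply/orP; left; apply/eqP.
  by field; rewrite gt_eqF.
- by apply: le_trans (enormD _ _) _; lra.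
- by apply: le_trans (enormD _ _) _; lra.
Qed.

Lemma closed_loop_le (kappa G kA' : R) : (1 <= t)%N -> s ^+ 2 <= kappa -> 1 <= G ->
  rho / (1 - rho) <= G ->
  kA' = a ^+ H.-1 + c ^+ 2 * (kappa + y) ->
  enorm (x t) <= kA' * rho ^+ (t.-1 %/ H) * enorm (x 1%N)
    + kA' * kA * kappa * G * wb.
Proof.
move=> t1 sk G1 rG kA'E; have s1 := s_ge1; have c1 := c_ge1.
have s2 : s <= s ^+ 2 by rewrite expr2; nra.
have A0 : 0 <= a ^+ H.-1 by exact: exprn_ge0.
have r1 : 0 < 1 - rho by rewrite subr_gt0.
have r0 : 0 <= rho / (1 - rho) by rewrite divr_ge0 // ltW.
(* Time starts at 1, so k blocks are complete at time t and j steps of the next one have been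
   made. *)
pose k := (t.-1 %/ H)%N; pose j := (t.-1 %% H)%N.
have tE : t = ((k * H).+1 + j)%N by rewrite addSn -divn_eq prednK.
have jH : (j < H)%N by rewrite ltn_mod.
have kt : (k * H < t)%N by nat_lia.
have [h [e [xE hk ek en en2]]] := block_decomposition kt.
pose tau := (k * H).+1.
have tau_mod : tau = 1 %[mod H] by rewrite /tau -addn1 modnMDl.
have [Sig Sopt uE] := proj2 loop tau isT tau_mod.
pose K := sdp_gain Sig.
have xt : x t = flow A B K tau j h + (flow A B K tau j e + response A w tau j).
  rewrite {1}tE (trajectory_flow (isT : (1 <= tau)%N) (ltnW jH) uE) xE flowD.
  exact: esym (addrA _ _ _).
pose N := s * rho ^+ k * enorm (x 1%N).
have rk0 : 0 <= rho ^+ k by exact: exprn_ge0.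
have hw : Num.sqrt (spnorm W) * wnorm h <= N.
  apply: le_trans (ler_wpM2l (sqrtr_ge0 _) hk) _.
  apply: le_trans (ler_wpM2l (sqrtr_ge0 _) (ler_wpM2l rk0 (wnorm_le_enorm _))) _.
  by rewrite le_eqVlt; apply/orP; left; apply/eqP; rewrite /N sE; ring.
have hN : enorm h <= N by exact: le_trans (enorm_le_wnorm h) hw.
have fhN : enorm (flow A B K tau H h) <= N.
  apply: le_trans (enorm_le_wnorm _) _; apply: le_trans hw.
  rewrite ler_wpM2l ?sqrtr_ge0 //; apply: le_trans (wnorm_flow_le h Sopt) _.
  by rewrite ler_piMl ?sqrtr_ge0 ?ltW.
have hom := flow_transient_le (isT : (1 <= tau)%N) Sopt jH s1 hN fhN.
(* The factor s in [N] cancels against the one on the left of the transient estimate. *)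
have {}hom : enorm (flow A B K tau j h) <= kA' * rho ^+ k * enorm (x 1%N).
  have sp : 0 < s by lra.
  rewrite -(ler_pM2l sp); apply: le_trans hom _.
  have -> : s * (kA' * rho ^+ k * enorm (x 1%N)) = kA' * N by rewrite /N; ring.
  apply: ler_wpM2r; first by exact: le_trans (enorm_ge0 _) hN.
  rewrite kA'E; have := ler_wpM2l (sqr_ge0 c) (_ : s ^+ 2 + y <= kappa + y).
  by rewrite lerD2r => /(_ sk); lra.
pose E1 := 1 + s * (rho / (1 - rho)); pose F := s ^+ 2 * G.
(* Both bounds on e are kept: the first serves inside the block, the second at its start. *)
pose E := Num.min E1 (1 + c * y * E1).
have cy0 : 0 <= c * y by rewrite mulr_ge0 ?(ltW y0) //; lra.
have F1 : 1 <= F by rewrite /F; nra.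
have sr : s * (rho / (1 - rho)) <= F.
  rewrite /F; apply: le_trans (ler_wpM2l (_ : 0 <= s) rG) _; first lra.
  by rewrite ler_wpM2r //; lra.
have E10 : 0 <= E1 by rewrite /E1; have := mulr_ge0 (le_trans ler01 s1) r0; lra.
have E2 : E1 <= 2 * F by rewrite /E1; lra.
have eE : enorm e <= E * (kA * wb).
  by rewrite /E minElt; case: ifP.
have E0 : 0 <= E by rewrite /E le_min E10 addr_ge0 // mulr_ge0.
have EF : E <= 2 * F by rewrite /E ge_min E2.
have EF2 : E <= (1 + 2 * (c * y)) * F.
  rewrite /E ge_min; apply/orP; right; have := ler_wpM2l cy0 E2; lra.
have dist := flow_disturbance_le (isT : (1 <= tau)%N) Sopt jH wb0 F1 E0 EF EF2 eE.
have {}dist : enorm (flow A B K tau j e) + geosum a j * wb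
    <= kA' * kA * kappa * G * wb.
  apply: le_trans dist _.
  have -> : kA' * kA * kappa * G * wb = kappa * G * kA' * (kA * wb) by ring.
  apply: ler_wpM2r => //; apply: ler_pM.
  - lra.
  - by rewrite addr_ge0 // mulr_ge0 ?sqr_ge0 // addr_ge0 // ltW.
  - by rewrite /F ler_wpM2r //; lra.
  - by rewrite kA'E lerD2l ler_wpM2l ?sqr_ge0 // lerD2r; lra.
have dj := @disturbance_le tau j isT (eq_leq (esym tE)).
rewrite xt; apply: le_trans (enormD _ _) _; apply: lerD => //.
by apply: le_trans (enormD _ _) _; lra.
Qed.

End Trajectory.
End ClosedLoop.

(** t / H - 1 is at most the number of complete blocks, and powers of r decrease. *)
Lemma expr_le_epow (R : realType) (r : R) (H t : nat) : 0 <= r < 1 ->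
  (1 <= H)%N -> (1 <= t)%N ->
  ((r ^+ (t.-1 %/ H))%:E <= epow r (t%:R / H%:R - 1))%E.
Proof.
move=> /andP[r0 r1] H1 t1; set k := (t.-1 %/ H)%N.
have Hp : 0 < H%:R :> R by rewrite ltr0n.
have tk : (t <= k.+1 * H)%N by have := ltn_ceil t.-1 H1; rewrite prednK.
have ek : t%:R / H%:R - 1 <= k%:R :> R.
  by rewrite lerBlDr -[X in _ + X]/(1%:R) -natrD addn1 ler_pdivrMr // -natrM ler_nat.
rewrite /epow; case: ifP => [_|]; first exact: leey.
rewrite lee_fin; have [->|rn] := eqVneq r 0; last first.
  move=> _; rewrite -powR_mulrn //; apply: ger_powR => //.
  by rewrite lt_neqAle eq_sym rn r0 ltW.
rewrite /= => /negbT; rewrite -leNgt => e0.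
(* For r = 0 and k = 0 the exponent is squeezed to 0, where both powers are 1. *)
case: k ek tk => [|k] ek tk; last by rewrite exprS mul0r powR_ge0.
have -> : t%:R / H%:R - 1 = 0 :> R by apply/eqP; rewrite eq_le ek.
by rewrite powRr0 expr0.
Qed.

Theorem theorem7 (R : realType) (d p H : nat)
    (Q : 'M[R]_d) (Rc : 'M[R]_p) (W : 'M[R]_d) (alpha a b sigma : R)
    (A : nat -> 'M[R]_d) (B : nat -> 'M[R]_(d, p))
    (Q_pd : posdef Q) (Rc_pd : posdef Rc) (W_pd : posdef W)
    (H_ge1 : (1 <= H)%N) (alpha_ge0 : 0 <= alpha) (alpha_lt1 : alpha < 1)
    (sigma_gt0 : 0 < sigma) (a_gt0 : 0 < a) (b_gt0 : 0 < b)
    (controllable : forall t : nat, (1 <= t)%N ->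
       loewner_le sigma%:M (lifted_B H A B t *m (lifted_B H A B t)^T))
    (A_le : forall t : nat, (1 <= t)%N -> spnorm (A t) <= a)
    (B_le : forall t : nat, (1 <= t)%N -> spnorm (B t) <= b) :
  (forall t : nat, (1 <= t)%N -> t = 1 %[mod H] ->
     exists Sigma : 'M[R]_(d + stack H p), sdp_feasible alpha W A B t Sigma)
  /\
  (alpha < 1 / 2 ->
   let rho := Num.sqrt (alpha / (1 - alpha)) in
   let kappa := cond_number W / Num.sqrt (1 - alpha) in
   let kappa_A := \sum_(i < H) a ^+ i in
   let kappa_A' := a ^+ H.-1 +
     b ^+ 2 * (\sum_(i < H) a ^+ i) ^+ 2 * cond_number Rc *
       ((kappa + a ^+ H) / sigma) in
   0 <= rho < 1 /\
   forall (x : nat -> 'cV[R]_d) (u : nat -> 'cV[R]_p) (w : nat -> 'cV[R]_d),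
     closed_loop H alpha Q Rc W A B x u w ->
     forall t : nat, (1 <= t)%N ->
     ((enorm (x t))%:E <=
        kappa_A'%:E * epow rho (t%:R / H%:R - 1) * (enorm (x 1%N))%:E +
        (kappa_A' * kappa_A * kappa * Num.max 1 (rho / (1 - rho)) *
           \big[Num.max/0]_(1 <= s < t) enorm (w s))%:E)%E).
Proof.
have a0 : 0 <= a by exact: ltW.
have alpha01 : 0 <= alpha < 1 by rewrite alpha_ge0.
have Aa i : (1 <= i)%N -> opbound (A i) a by move=> /A_le /opbound_spnorm.
have Bb i : (1 <= i)%N -> opbound (B i) b by move=> /B_le /opbound_spnorm.
split=> [t t1 _|alpha_lt rho kappa kA kA'].
  exact: sdp_feasible_exists W_pd alpha_ge0 sigma_gt0 (controllable t t1).
have a1 : 0 < 1 - alpha by lra.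
have rho0 : 0 <= rho by exact: sqrtr_ge0.
have rho1 : rho < 1.
  by rewrite -[X in _ < X]sqrtr1 ltr_sqrt ?ltr01 // ltr_pdivrMr //; lra.
split=> [|x u w loop t t1]; first by rewrite rho0.
set wb := \big[Num.max/0]_(_ <= _ < _) _.
have wb0 : 0 <= wb by exact: bigmax_ge_id.
have kappaW : cond_number W <= kappa.
  have s1 : Num.sqrt (1 - alpha) <= 1.
    by rewrite -[X in _ <= X]sqrtr1 ler_sqrt //; lra.
  rewrite ler_pdivlMr ?sqrtr_gt0 //.
  by rewrite ler_piMr ?cond_number_ge0.
have kappa0 : 0 <= kappa by exact: le_trans (cond_number_ge0 W) kappaW.
have kA0 : 0 <= kA by exact: geosum_ge0.
have kA'0 : 0 < kA'.
  rewrite ltr_pwDl ?exprn_gt0 // mulr_ge0 //.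
    by rewrite mulr_ge0 ?cond_number_ge0 // -exprMn sqr_ge0.
  by apply: divr_ge0; rewrite ?(ltW sigma_gt0) // addr_ge0 // exprn_ge0.
have max0 : 0 <= Num.max 1 (rho / (1 - rho)) by rewrite le_max ler01.
have D0 : 0 <= kA' * kA * kappa * Num.max 1 (rho / (1 - rho)) * wb.
  by do 4!apply: mulr_ge0 => //; exact: ltW.
have ep0 : (0 <= epow rho (t%:R / H%:R - 1))%E.
  by rewrite /epow; case: ifP => // _; rewrite lee_fin powR_ge0.
(* In dimension 0 condition numbers are 0 and the estimates above fail, but the state has norm 0. *)
case: (posnP d) => [d0|d0].
  rewrite (enorm_dim0 (x t) d0) adde_ge0 ?lee_fin //.
  by rewrite !mule_ge0 // lee_fin ?enorm_ge0 // ltW.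
have w_le i : (1 <= i < t)%N -> enorm (w i) <= wb.
  move=> it; apply: (le_bigmax_seq 0 i xpredT (fun i => enorm (w i))) => //.
  by rewrite mem_index_iota.
have key : enorm (x t) <= kA' * rho ^+ (t.-1 %/ H) * enorm (x 1%N)
    + kA' * kA * kappa * Num.max 1 (rho / (1 - rho)) * wb.
  apply: (closed_loop_le (b := b) (sigma := sigma) Q_pd Rc_pd W_pd H_ge1 alpha01
    sigma_gt0 a_gt0 b_gt0 controllable Aa Bb d0 loop rho1 wb0 w_le t1).
  - by rewrite sqr_sqrtr ?cond_number_ge0.
  - by rewrite le_max lexx.
  - by rewrite le_max lexx orbT.
  - rewrite c_sqr // /kA'; congr (_ + _); rewrite /geosum; ring.
apply: (@le_trans _ _ (kA' * rho ^+ (t.-1 %/ H) * enorm (x 1%N)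
    + kA' * kA * kappa * Num.max 1 (rho / (1 - rho)) * wb)%:E).
  by rewrite lee_fin.
rewrite EFinD leeD2r // !EFinM lee_wpmul2r ?lee_fin ?enorm_ge0 //.
rewrite lee_wpmul2l ?lee_fin ?(ltW kA'0) //.
by apply: expr_le_epow; rewrite ?rho0.
Qed.
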